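(* Let $n\ge2$, $m>0$, $\beta>0$. For $d\ge2$ let $(g_x)_{x\in\mathcal X}$ be the Gaussian free field without boundary ($\partial=\emptyset$) on $\mathcal X=\{0,1,\ldots,n-1\}^d$ with nearest-neighbour interaction, as defined in the context. For $(x,x')\in\mathcal X\times\mathcal X$, the field satisfies the following. (i) For a fixed Hamming distance $\rho=\rho(x,x')$, we have $$\mathrm{Cov}(g_x,g_{x'})=\frac{\rho!}{\beta\{1+m^2\}^{\rho+1}}\,e^{-\rho\log\{(n-1)d\}}\{1+O(d^{-1})\},\qquad d\to\infty.$$ (ii) For $\rho(x,x')=\sigma d$, $\sigma\in(0,1]$, the covariance $\mathrm{Cov}(g_x,g_{x'})$ decays exponentially in $\sigma$ as $d\to\infty$. Moreover, the exponential decay rate is strictly increasing in $\sigma$.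
   Context: $\rho(x,x')=|\{i:x_i\ne x_i'\}|$ is the Hamming distance and $R_1=\{(x,x')\in\mathcal X\times\mathcal X:\rho(x,x')=1\}$ (ordered pairs). The Hamiltonian is $$H\{(\xi_x)_{x\in\mathcal X}\}=\frac14\sum_{(x,x')\in R_1}\frac1{(n-1)d}(\xi_x-\xi_{x'})^2+\frac{m^2}2\sum_{x\in\mathcal X}\xi_x^2 ,$$ and $(g_x)_{x\in\mathcal X}$ is the centred Gaussian random vector in $\mathbb R^{\mathcal X}$ whose law is the Gibbs measure with density proportional to $e^{-\beta H}$. *)

(* Defs.v *)
From HB Require Import structures.
From mathcomp Require Import all_boot all_order all_algebra.
From mathcomp Require Import all_classical all_reals all_analysis.

Set Implicit Arguments.
Unset Strict Implicit.
Unset Printing Implicit Defensive.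

Import Order.TTheory GRing.Theory Num.Theory.
Import numFieldNormedType.Exports.

Local Open Scope classical_set_scope.
Local Open Scope ring_scope.

Section tuple_measure.
Context {d} {T : measurableType d} {R : realType}.
Variable nu : {sigma_finite_measure set T -> \bar R}.

Definition tuple_cons N (p : T * N.-tuple T) : N.+1.-tuple T :=
  [tuple of p.1 :: p.2].

Definition tuple_uncons N (t : N.+1.-tuple T) : T * N.-tuple T :=
  (thead t, [tuple of behead t]).

Lemma tuple_consK N : cancel (@tuple_cons N) (@tuple_uncons N).
Proof. by case=> x t; congr (_, _); apply: val_inj. Qed.

Lemma tuple_unconsK N : cancel (@tuple_uncons N) (@tuple_cons N).
Proof. by move=> t; rewrite [RHS]tuple_eta. Qed.

Lemma measurable_tuple_cons N :
  measurable_fun [set: T * N.-tuple T] (@tuple_cons N).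
Proof. exact: (measurable_cons measurable_fst measurable_snd). Qed.

Lemma measurable_tuple_uncons N :
  measurable_fun [set: N.+1.-tuple T] (@tuple_uncons N).
Proof.
apply: measurable_fun_pair; first exact: measurable_tnth.
apply/measurable_fun_tnthP => i.
rewrite (_ : _ \o _ = (@tnth _ T)^~ (lift ord0 i)); last first.
  by apply/funext => t /=; rewrite tnth_behead; congr tnth;
    apply/val_inj; rewrite /= inordK ?ltnS.
exact: measurable_tnth.
Qed.

Section cons_measure.
Variables (N : nat) (mu : {sigma_finite_measure set (N.-tuple T) -> \bar R}).

Definition cons_measure : set (N.+1.-tuple T) -> \bar R :=
  pushforward (nu \x mu)%E (@tuple_cons N).

Let cons_measure0 : cons_measure set0 = 0%E.
Proof. by rewrite /cons_measure /pushforward preimage_set0 measure0. Qed.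

Let cons_measure_ge0 A : (0 <= cons_measure A)%E.
Proof. by rewrite /cons_measure /pushforward measure_ge0. Qed.

Let cons_measure_semi_sigma_additive : semi_sigma_additive cons_measure.
Proof.
rewrite /cons_measure => F mF tF mUF; rewrite /pushforward preimage_bigcup.
apply: measure_semi_sigma_additive.
- by move=> n; rewrite -[X in measurable X]setTI; exact: measurable_tuple_cons.
- apply/trivIsetP => /= i j _ _ ij; rewrite -preimage_setI.
  by move/trivIsetP : tF => /(_ _ _ _ _ ij) ->//; rewrite preimage_set0.
- rewrite -preimage_bigcup -[X in measurable X]setTI.
  exact: measurable_tuple_cons.
Qed.

HB.instance Definition _ := isMeasure.Build _ _ _ cons_measure
  cons_measure0 cons_measure_ge0 cons_measure_semi_sigma_additive.

Let cons_measure_sigma_finite : sigma_finite setT cons_measure.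
Proof.
have /sigma_finiteP[F [TF ndF Foo]] := sigma_finiteT nu.
have /sigma_finiteP[G [TG ndG Goo]] := sigma_finiteT mu.
exists (fun n => @tuple_uncons N @^-1` (F n `*` G n)).
  rewrite -preimage_bigcup; apply/esym; rewrite -subTset => t _ /=.
  have [n _ Fn] : (\bigcup_j F j) (thead t) by rewrite -TF.
  have [k _ Gk] : (\bigcup_j G j) [tuple of behead t] by rewrite -TG.
  exists (maxn n k) => //; split => /=.
  - by move: Fn; exact/subsetPset/ndF/leq_maxl.
  - by move: Gk; exact/subsetPset/ndG/leq_maxr.
move=> n; have [mF Fnoo] := Foo n; have [mG Gnoo] := Goo n; split.
  rewrite -[X in measurable X]setTI; apply: measurable_tuple_uncons => //.
  exact: measurableX.
rewrite /cons_measure /pushforward.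
rewrite (_ : _ @^-1` (_ @^-1` _) = F n `*` G n); last first.
  rewrite -comp_preimage (_ : _ \o _ = id) ?preimage_id//.
  by apply/funext => p; exact: tuple_consK.
by rewrite product_measure1E// lte_mul_pinfty// ge0_fin_numE.
Qed.

HB.instance Definition _ := Measure_isSigmaFinite.Build _ _ _ cons_measure
  cons_measure_sigma_finite.

End cons_measure.

Fixpoint tuple_measure N : {sigma_finite_measure set (N.-tuple T) -> \bar R} :=
  match N with
  | 0 => \d_([tuple] : 0.-tuple T)
  | N'.+1 => cons_measure (tuple_measure N')
  end.

End tuple_measure.

Definition lebesgue_tuple (R : realType) (N : nat) :
    {sigma_finite_measure set (N.-tuple (measurableTypeR R)) -> \bar R} :=
  tuple_measure lebesgue_measure N.

Section hamming_gff.
Variables n d : nat.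

Definition config := {ffun 'I_d -> 'I_n}.

Definition hamming (x y : config) : nat := #|[set i | x i != y i]|%SET.

Definition hamiltonian (R : realType) (m : R) (xi : config -> R) : R :=
  4^-1 * (\sum_(p : config * config | hamming p.1 p.2 == 1%N)
            (((n - 1) * d)%N%:R)^-1 * (xi p.1 - xi p.2) ^+ 2)
  + m ^+ 2 / 2 * \sum_(x : config) xi x ^+ 2.

(* R^config is represented by #|config|-tuples, coordinates being indexed
   through the enumeration of config. *)
Definition field_of_tuple (R : realType)
    (v : #|{: config}|.-tuple (measurableTypeR R)) : config -> R :=
  fun x => tnth v (enum_rank x).

Definition tuple_of_field (R : realType) (xi : config -> R) :
    #|{: config}|.-tuple (measurableTypeR R) :=
  [tuple (xi (enum_val i) : measurableTypeR R) | i < #|{: config}|].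

Lemma tuple_of_fieldK (R : realType) (xi : config -> R) :
  field_of_tuple (tuple_of_field xi) = xi.
Proof.
by apply/funext => x; rewrite /field_of_tuple tnth_mktuple enum_rankK.
Qed.

Lemma field_of_tupleK (R : realType)
    (v : #|{: config}|.-tuple (measurableTypeR R)) :
  tuple_of_field (field_of_tuple v) = v.
Proof.
by apply: eq_from_tnth => i; rewrite tnth_mktuple /field_of_tuple enum_valK.
Qed.

(* The joint law of (g x)_x has a density proportional to
   expR (- beta * hamiltonian m _) with respect to Lebesgue measure; the
   constant c is determined by P being a probability. *)
Definition is_gff (R : realType) (m beta : R) (disp : measure_display)
    (Omega : measurableType disp) (P : probability Omega R)
    (g : config -> {RV P >-> R}) : Prop :=
  exists c : R, forall A : set (#|{: config}|.-tuple (measurableTypeR R)),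
    measurable A ->
    P [set w | A (tuple_of_field (fun x => g x w))] =
    (\int[lebesgue_tuple R #|{: config}|]_(v in A)
       (c * expR (- beta * hamiltonian m (field_of_tuple v)))%:E)%E.

End hamming_gff.

(* Main.v *)
(* The Hamiltonian is half the quadratic form of the operator (1 + m^2) - W, W
   being the transition matrix of simple random walk on the Hamming graph, so
   that the covariance is the Green function ((1 + m^2) - W)^-1 / beta.

   Gaussian part. Translating the Lebesgue measure by h in the normalization of
   the Gibbs measure gives E exp(- beta B(h, g)) = exp(beta H(h)), B being the
   bilinear form of H. If B(u, .) is beta^-1 times a linear functional l, then
   l(g) has Laplace transform exp(t^2 l(u) / 2), hence variance l(u).

   Green function. A radial function k(rho) inverts the operator iff it solves a
   three-term recurrence, and its quotients r_rho = k(rho) / k(rho - 1) solve a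
   backward first order recurrence r_rho = step(rho / d, r_(rho+1)) started from
   r_(d+1) = 0. For a fixed rho all its denominators are 1 + m^2 + O(1/d), which
   gives (i).

   Decay rate. The map step is increasing in both arguments, so that r_rho
   decreases when d grows and rho / d does not. Hence the normalized sums
   d^-1 sum_(rho <= sigma d) - ln r_rho converge to their supremum over d, which
   is the rate; as - ln r_rho >= ln (1 + m^2), it increases with slope at least
   ln (1 + m^2). *)

Require Import Defs.
From HB Require Import structures.
From mathcomp Require Import all_boot all_order all_algebra.
From mathcomp Require Import all_classical all_reals all_analysis.
From mathcomp Require Import measurable_realfun ring lra.

Set Implicit Arguments.
Unset Strict Implicit.
Unset Printing Implicit Defensive.

Import Order.TTheory GRing.Theory Num.Theory.
Import numFieldNormedType.Exports.

Local Open Scope classical_set_scope.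
Local Open Scope ring_scope.

(** * Densities and translations of the Lebesgue measure *)

Section density.
Local Open Scope ereal_scope.
Context d (T : measurableType d) (R : realType).
Variables (mu nu : {measure set T -> \bar R}) (h : T -> R).
Hypothesis mh : measurable_fun setT h.
Hypothesis h0 : forall x, (0 <= h x)%R.
Hypothesis nuE : forall A, measurable A -> nu A = \int[mu]_(x in A) (h x)%:E.

Let mhE : measurable_fun setT (fun x => (h x)%:E).
Proof. exact/measurable_EFinP. Qed.

Import HBNNSimple.

Let density_indic (A : set T) : measurable A ->
  \int[nu]_x (\1_A x)%:E = \int[mu]_x ((\1_A x)%:E * (h x)%:E).
Proof.
move=> mA; rewrite integral_indic// setIT nuE//.
rewrite integral_mkcond; apply: eq_integral => x _.
by rewrite patchE indicE; case: (x \in A); rewrite ?mul1e ?mul0e.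
Qed.

Let density_nnsfun (f : {nnsfun T >-> R}) :
  \int[nu]_x (f x)%:E = \int[mu]_x ((f x)%:E * (h x)%:E).
Proof.
under eq_integral do rewrite fimfunE -fsumEFin//.
rewrite ge0_integral_fsum//; last 2 first.
- by move=> r; exact/measurable_EFinP/measurable_funM.
- by move=> r x _; rewrite nnfun_muleindic_ge0.
transitivity (\int[mu]_x (\sum_(r \in range f)
    (r * \1_(f @^-1` [set r]) x)%:E * (h x)%:E)).
  rewrite ge0_integral_fsum//; last 2 first.
  - move=> r; apply: emeasurable_funM => //.
    exact/measurable_EFinP/measurable_funM.
  - by move=> r x _; rewrite mule_ge0 ?nnfun_muleindic_ge0 ?lee_fin.
  apply: eq_fsbigr => r /[!inE] -[y _ <-].
  rewrite integralZl_indic_nnsfun// density_indic//.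
  rewrite -ge0_integralZl//.
  - by apply: eq_integral => x _; rewrite EFinM muleA.
  - by apply: emeasurable_funM => //; exact/measurable_EFinP.
  - by move=> x _; rewrite mule_ge0// lee_fin.
  - by rewrite lee_fin.
apply: eq_integral => x _; rewrite [in RHS]fimfunE -fsumEFin//.
rewrite ge0_mule_fsuml// => r; exact: nnfun_muleindic_ge0.
Qed.

(** The hypothesis [nuE] settles indicators, linearity settles simple functions, and monotone
    convergence along [nnsfun_approx] on both sides gives the general case. *)
Lemma ge0_integral_density (f : T -> \bar R) :
  measurable_fun setT f -> (forall x, 0 <= f x) ->
  \int[nu]_x f x = \int[mu]_x (f x * (h x)%:E).
Proof.
move=> mf f0; pose f_ := nnsfun_approx measurableT mf.
transitivity (limn (fun n => \int[nu]_x (f_ n x)%:E)).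
  rewrite -monotone_convergence//.
  - apply: eq_integral => y _; apply/esym/cvg_lim => //.
    exact: cvg_nnsfun_approx.
  - by move=> n; exact/measurable_EFinP/measurable_funP.
  - by move=> n y _; rewrite lee_fin.
  - by move=> y _ m n mn; rewrite lee_fin; exact/lefP/nd_nnsfun_approx.
under eq_fun do rewrite density_nnsfun.
rewrite -monotone_convergence//.
- apply: eq_integral => y _; apply/cvg_lim => //.
  by apply: cvgeZr => //; exact: cvg_nnsfun_approx.
- move=> n; apply: emeasurable_funM => //.
  exact/measurable_EFinP/measurable_funP.
- by move=> n y _; rewrite mule_ge0 ?lee_fin.
- move=> y _ m n mn; apply: lee_wpmul2r; rewrite ?lee_fin//.
  exact/lefP/nd_nnsfun_approx.
Qed.

End density.

(** * Translation invariance of the Lebesgue measure on tuples *)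

Section translation.
Context (R : realType).
Local Open Scope ereal_scope.

(** By uniqueness of the Lebesgue measure it suffices to compare on half-open intervals, whose
    preimages are intervals of the same length. *)
Lemma lebesgue_measureDr (a : R) (A : set (measurableTypeR R)) : measurable A ->
  pushforward lebesgue_measure
    ((fun x => x + a)%R : measurableTypeR R -> measurableTypeR R) A
  = lebesgue_measure A.
Proof.
move=> mA; apply: esym; apply: lebesgue_measure_unique => //=.
  exact: measurable_funD.
move=> mD _ [[b c]] _ <-.
rewrite /pushforward.
rewrite (_ : _ @^-1` _ = `]b - a, c - a]%classic)%R; last first.
  by apply/seteqP; split => x /=; rewrite !in_itv/= ltrBlDr lerBrDr.
rewrite !lebesgue_measure_itv/= !lte_fin ltrD2r; case: ifP => // _.
by rewrite -!EFinB; congr EFin; ring.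
Qed.

Lemma ge0_integral_lebesgueDr (a : R) (f : R -> \bar R) :
  measurable_fun setT f -> (forall x, 0 <= f x) ->
  \int[lebesgue_measure]_x f (x + a)%R = \int[lebesgue_measure]_x f x.
Proof.
move=> mf f0.
have mD : measurable_fun setT
    ((fun x => x + a)%R : measurableTypeR R -> measurableTypeR R).
  exact: measurable_funD.
transitivity (\int[pushforward lebesgue_measure
    ((fun x => x + a)%R : measurableTypeR R -> measurableTypeR R)]_x f x).
  by rewrite ge0_integral_pushforward//.
by apply: eq_measure_integral => //= A mA _; exact: lebesgue_measureDr.
Qed.

Definition tuple_shift N (h v : N.-tuple (measurableTypeR R)) :
    N.-tuple (measurableTypeR R) :=
  [tuple (tnth v i + tnth h i)%R : measurableTypeR R | i < N].

Lemma measurable_tuple_shift N (h : N.-tuple (measurableTypeR R)) :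
  measurable_fun setT (tuple_shift h).
Proof.
apply/measurable_fun_tnthP => i.
rewrite (_ : _ \o _ = fun v => (tnth v i + tnth h i)%R); last first.
  by apply/funext => v /=; rewrite tnth_mktuple.
apply: measurable_funD => //; exact: measurable_tnth.
Qed.

Lemma tuple_shift_cons N (h : N.+1.-tuple (measurableTypeR R)) p :
  tuple_shift h (tuple_cons p) =
  tuple_cons ((p.1 + thead h)%R : measurableTypeR R,
              tuple_shift [tuple of behead h] p.2).
Proof.
apply: eq_from_tnth => i; rewrite tnth_mktuple.
case: (unliftP ord0 i) => [j|] ->.
  rewrite !tnthS tnth_mktuple tnth_behead.
  by congr (_ + tnth _ _)%R; apply/val_inj; rewrite /= inordK ?ltnS.
by rewrite !tnth0.
Qed.

(** Induction on N: Tonelli splits off the first coordinate, the inner shift is the induction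
    hypothesis and the outer one is the one-dimensional case. *)
Lemma ge0_integral_tuple_shift N (h : N.-tuple (measurableTypeR R))
    (f : N.-tuple (measurableTypeR R) -> \bar R) :
  measurable_fun setT f -> (forall v, 0 <= f v) ->
  \int[lebesgue_tuple R N]_v f (tuple_shift h v) =
  \int[lebesgue_tuple R N]_v f v.
Proof.
elim: N h f => [|N IH] h f mf f0.
  by apply: eq_integral => v _; rewrite (tuple0 v) (tuple0 (tuple_shift _ _)).
have consE (F : N.+1.-tuple (measurableTypeR R) -> \bar R) :
    measurable_fun setT F -> (forall v, 0 <= F v) ->
    \int[lebesgue_tuple R N.+1]_v F v =
    \int[lebesgue_measure]_x \int[lebesgue_tuple R N]_v F (tuple_cons (x, v)).
  move=> mF F0.
  transitivity (\int[pushforward (lebesgue_measure \x lebesgue_tuple R N)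
      (@tuple_cons _ _ N)]_v F v) => //.
  rewrite ge0_integral_pushforward//; last exact: measurable_tuple_cons.
  rewrite preimage_setT fubini_tonelli1//.
    by apply: measurableT_comp => //; exact: measurable_tuple_cons.
  by move=> x /=.
rewrite !consE//; last exact: measurableT_comp (measurable_tuple_shift _).
have mfc : measurable_fun setT (fun p => f (tuple_cons p)).
  by apply: measurableT_comp => //; exact: measurable_tuple_cons.
under eq_integral do under eq_integral do rewrite tuple_shift_cons/=.
under eq_integral => x _.
  rewrite (IH _ (fun v => f (tuple_cons
    ((x + thead h)%R : measurableTypeR R, v))))//; last first.
    apply: (measurableT_comp mfc).
    exact: measurable_pair1.
  over.
rewrite (@ge0_integral_lebesgueDr (thead h)
  (fun x => \int[lebesgue_tuple R N]_v f (tuple_cons (x, v))))//.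
  exact: (@measurable_fun_fubini_tonelli_F _ _ _ _ _ _
    (fun p => f (tuple_cons p))).
by move=> x; exact: integral_ge0.
Qed.

End translation.

(** * Bounds on the exponential *)

Section expR_bounds.
Context (R : realType).
Implicit Types t x y k : R.

Lemma expRB1_le y : expR y - 1 <= y * expR y.
Proof.
have := expR_ge1Dx (- y); rewrite expRN => h.
have e0 := expR_gt0 y.
have := ler_wpM2r (ltW e0) h; rewrite mulVf ?gt_eqF//; lra.
Qed.

Lemma expR_sqr_le x : 0 <= x -> x ^+ 2 <= 2 * expR x.
Proof.
by move=> x0; have := expR_ge1Dxn 1 x0; rewrite (_ : 2`! = 2)%N// => h; lra.
Qed.

Lemma expR_cube_le x : 0 <= x -> x ^+ 3 <= 6 * expR x.
Proof.
by move=> x0; have := expR_ge1Dxn 2 x0; rewrite (_ : 3`! = 6)%N// => h; lra.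
Qed.

(* Tangent line of [expR] at [t x], evaluated at [0] and at [x]. *)
Lemma expR_chord t x : 0 <= t <= 1 -> expR (t * x) <= 1 - t + t * expR x.
Proof.
move=> /andP[t0 t1].
have tan y : expR (t * x) * (1 + (y - t * x)) <= expR y.
  rewrite [leRHS](_ : _ = expR (t * x) * expR (y - t * x)); last first.
    by rewrite -expRD addrC subrK.
  by rewrite ler_wpM2l ?expR_ge0// expR_ge1Dx.
have h0 := tan 0; rewrite expR0 in h0.
have h1 := tan x.
have := lerD (ler_wpM2l (_ : 0 <= 1 - t) h0) (ler_wpM2l t0 h1).
rewrite subr_ge0 => /(_ t1); set e := expR (t * x); lra.
Qed.

(** The error is of order [t ^+ 3] times a weight in x with finite mean, so the second moment can be
    read off the Laplace transform without differentiating under the integral. *)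
Lemma cosh_approx_ge0 t x : 0 <= t <= 1 -> 0 <= x ->
  `|expR (t * x) + expR (- (t * x)) - 2 - (t * x) ^+ 2|
    <= 6 * t ^+ 3 * (expR x + expR (- x)) ^+ 2.
Proof.
move=> t01 x0; have /andP[t0 t1] := t01.
have y0 : 0 <= t * x by rewrite mulr_ge0.
have := expR_chord x t01; have := expRB1_le (t * x); have := expR_ge1Dx (t * x).
have := expR_ge1Dx (- (t * x)); have := expR_gt0 (t * x).
have yE : expR (t * x) * expR (- (t * x)) = 1 by rewrite -expRD subrr expR0.
have xE : expR x * expR (- x) = 1 by rewrite -expRD subrr expR0.
have x2 := expR_sqr_le x0; have x3 := expR_cube_le x0.
have x1 := expR_ge1Dx x; have xN0 := expR_gt0 (- x).
move: yE xE x2 x3 x1 xN0.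
set e := expR (t * x); set e' := expR (- (t * x)).
set f := expR x; set f' := expR (- x).
move=> yE xE x2 x3 x1 xN0 e0 e'1 e1 eB1 ef.
(* Both factors are controlled by the tangent line: [e - 1] lies between [t * x] and [t * x * e],
   while [1 - e'] equals [(e - 1) * e'] and is at most [t * x]. *)
have E2 : e + e' - 2 = (e - 1) * (1 - e').
  by rewrite mulrBl mulrBr yE; ring.
have e'0 : 0 < e' by exact: expR_gt0.
have t3 : 0 <= t ^+ 3 by rewrite exprn_ge0.
have f1 : 1 <= f by lra.
have ff' : f ^+ 2 <= (f + f') ^+ 2 by nra.
rewrite ler_norml; apply/andP; split.
- have : (t * x) ^+ 2 * e' <= e + e' - 2.
    rewrite E2.
    have -> : 1 - e' = (e - 1) * e' by rewrite mulrBl yE mul1r.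
    rewrite mulrA -expr2.
    by rewrite ler_pM2r// lerXn2r ?nnegrE//; lra.
  have : (t * x) ^+ 2 * (1 - e') <= (t * x) ^+ 3.
    by rewrite [leRHS]exprSr ler_wpM2l ?sqr_ge0//; lra.
  rewrite [in X in X -> _]exprMn.
  have : t ^+ 3 * x ^+ 3 <= t ^+ 3 * (6 * (f + f') ^+ 2).
    rewrite ler_wpM2l//; nra.
  rewrite exprMn; nra.
- have h : e + e' - 2 <= (t * x) ^+ 2 * e.
    rewrite E2 [leRHS](_ : _ = (t * x) * e * (t * x)); last by ring.
    have e'le1 : e' <= 1 by rewrite -yE ler_peMl// ?(ltW e'0)//; lra.
    by rewrite ler_pM//; lra.
  (* The chord bound [e - 1 <= t * f] supplies the third power of t. *)
  have : (t * x) ^+ 2 * (e - 1) <= t ^+ 3 * (2 * (f + f') ^+ 2).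
    apply: (@le_trans _ _ ((t * x) ^+ 2 * (t * f))).
      by rewrite ler_wpM2l ?sqr_ge0//; nra.
    rewrite (_ : _ * _ = t ^+ 3 * (x ^+ 2 * f)); last by ring.
    rewrite ler_wpM2l//; nra.
  nra.
Qed.

Lemma cosh_approx t x : 0 <= t <= 1 ->
  `|expR (t * x) + expR (- (t * x)) - 2 - (t * x) ^+ 2|
    <= 6 * t ^+ 3 * (expR x + expR (- x)) ^+ 2.
Proof.
move=> t01; have [x0|x0] := leP 0 x; first exact: cosh_approx_ge0.
have := cosh_approx_ge0 t01 (_ : 0 <= - x).
rewrite oppr_ge0 => /(_ (ltW x0)); rewrite mulrN !opprK sqrrN.
by rewrite [expR (- (t * x)) + _]addrC [expR (- x) + _]addrC.
Qed.

(** From [expR w - 1 <= w * expR w = w + w * (expR w - 1)], the last product is bounded according to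
    the sign of w. *)
Lemma expR_approx (w : R) : expR w - 1 <= w + w ^+ 2 * expR `|w|.
Proof.
have h1 := expRB1_le w; have h2 := expR_ge1Dx w.
have E1 : 1 <= expR `|w| by rewrite -expR0 ler_expR.
apply: (@le_trans _ _ (w + w * (expR w - 1))); first by lra.
rewrite lerD2l; have [w0|w0] := leP 0 w.
  by rewrite ger0_norm// expr2 -mulrA ler_wpM2l.
apply: (@le_trans _ _ (w ^+ 2)); last by rewrite ler_peMr ?sqr_ge0.
by rewrite expr2 ler_wnM2l ?(ltW w0)//; lra.
Qed.

(** Replaces the passage to the limit as t tends to 0 from above. *)
Lemma le_of_leD_scale (a b C : R) : 0 <= C ->
  (forall t, 0 < t <= 1 -> a <= b + t * C) -> a <= b.
Proof.
move=> C0 h; apply/ler_addgt0Pr => e e0.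
have D0 : 0 < C + e + 1 by lra.
have t01 : 0 < e / (C + e + 1) <= 1.
  by rewrite divr_gt0//= ler_pdivrMr// mul1r; lra.
apply: (le_trans (h _ t01)); rewrite lerD2l.
rewrite mulrAC ler_pdivrMr// ler_wpM2l//; lra.
Qed.

End expR_bounds.

(** * Variance of a variable with Gaussian Laplace transform *)

Section gaussian_moments.
Context disp (Omega : measurableType disp) (R : realType).
Variables (P : probability Omega R) (X : Omega -> R) (v : R).
Hypothesis mX : measurable_fun setT X.
Hypothesis mgfE : forall t,
  (\int[P]_w (expR (t * X w))%:E = (expR (t ^+ 2 * v / 2))%:E)%E.

Let iexp t : P.-integrable setT (EFin \o (fun w => expR (t * X w))).
Proof.
apply/integrableP; split.
  apply/measurable_EFinP; apply: measurableT_comp => //.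
  exact: measurable_funM.
under eq_integral do rewrite /= ger0_norm ?expR_ge0//.
by rewrite mgfE ltry.
Qed.

Let Eexp t : \int[P]_w expR (t * X w) = expR (t ^+ 2 * v / 2).
Proof. by rewrite /Rintegral mgfE. Qed.

Let icst (c : R) : P.-integrable setT (EFin \o (fun=> c)).
Proof. exact: finite_measure_integrable_cst. Qed.

Let iD (f g : Omega -> R) : P.-integrable setT (EFin \o f) ->
  P.-integrable setT (EFin \o g) ->
  P.-integrable setT (EFin \o (fun w => f w + g w)).
Proof.
move=> fi gi; rewrite (_ : _ \o _ = (EFin \o f) \+ (EFin \o g))%E.
  exact: integrableD.
by apply/funext.
Qed.

Let iZ (c : R) (f : Omega -> R) : P.-integrable setT (EFin \o f) ->
  P.-integrable setT (EFin \o (fun w => c * f w)).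
Proof. by move=> fi; exact: (integrableZl measurableT c fi). Qed.

Let ED (f g : Omega -> R) : P.-integrable setT (EFin \o f) ->
  P.-integrable setT (EFin \o g) ->
  \int[P]_w (f w + g w) = \int[P]_w f w + \int[P]_w g w.
Proof. by move=> fi gi; rewrite RintegralD. Qed.

Let EZ (c : R) (f : Omega -> R) : P.-integrable setT (EFin \o f) ->
  \int[P]_w (c * f w) = c * \int[P]_w f w.
Proof. by move=> fi; rewrite RintegralZl. Qed.

Let Ec (c : R) : \int[P]_w c = c.
Proof. by rewrite Rintegral_cst//= probability_setT /= mulr1. Qed.

Let iX2 : P.-integrable setT (EFin \o (fun w => X w ^+ 2)).
Proof.
(* The square is dominated by [2 * (expR X + expR (- X))], integrable by the Laplace transform at 1
   and -1. *)
apply: (@le_integrable _ _ _ _ _ measurableT _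
    (EFin \o (fun w => 2 * (expR (1 * X w) + expR (-1 * X w))))).
- by apply/measurable_EFinP; exact: measurable_funX.
- move=> w _ /=; rewrite lee_fin [leLHS]ger0_norm ?sqr_ge0//.
  rewrite [leRHS]ger0_norm; last by rewrite mulr_ge0// addr_ge0// expR_ge0.
  rewrite mul1r mulN1r; have [x0|x0] := leP 0 (X w).
    by have := expR_sqr_le x0; have := expR_gt0 (- X w); lra.
  have := @expR_sqr_le _ (- X w); rewrite sqrrN oppr_ge0 => /(_ (ltW x0)).
  by have := expR_gt0 (X w); lra.
- by apply: iZ; apply: iD; exact: iexp.
Qed.

Let X2 : X \in Lfun P 2%:E.
Proof.
rewrite inE/=; apply/andP; split; rewrite inE//=.
rewrite /finite_norm unlock poweR_lty//.
under eq_integral => w _ do rewrite /= powR_mulrn// real_normK ?num_real//.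
exact: integrable_lty iX2.
Qed.

Let iX : P.-integrable setT (EFin \o X).
Proof.
apply/Lfun1_integrable; apply: Lfun_subset12 => //.
exact: fin_num_measure.
Qed.

Let W w := (expR (X w) + expR (- X w)) ^+ 2.

Let WE w : W w = expR (2 * X w) + (2 + expR (- 2 * X w)).
Proof.
rewrite /W sqrrD -!expRM_natl -expRD subrr expR0 -mulr_natl mulr1.
by rewrite mulrN -mulNr; ring.
Qed.

Let iW : P.-integrable setT (EFin \o W).
Proof.
rewrite (_ : W = fun w => expR (2 * X w) + (2 + expR (- 2 * X w))).
  by apply: iD; [exact: iexp|apply: iD; [exact: icst|exact: iexp]].
by apply/funext => w; exact: WE.
Qed.

Let m := \int[P]_w X w.
Let s := \int[P]_w (X w ^+ 2).
(** The second summand is the remainder constant of [expR_approx] at [t ^+ 2 * v / 2] for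
    [|t| <= 1]; the first lets C also absorb the main term in [mean_le]. *)
Let C := `|v / 2| + (v / 2) ^+ 2 * expR `|v / 2|.

Let C0 : 0 <= C.
Proof. by rewrite addr_ge0// mulr_ge0 ?sqr_ge0 ?expR_ge0. Qed.

Let mgf_ub (t : R) : `|t| <= 1 ->
  expR (t ^+ 2 * v / 2) - 1 <= t ^+ 2 * (v / 2) + t ^+ 4 * C.
Proof.
move=> t1; rewrite -mulrA; apply: (le_trans (expR_approx _)); rewrite lerD2l.
rewrite exprMn -mulrA -exprM ler_wpM2l ?exprn_even_ge0//.
apply: (@le_trans _ _ ((v / 2) ^+ 2 * expR `|v / 2|)); last by rewrite lerDr.
rewrite ler_wpM2l ?sqr_ge0// ler_expR normrM ler_piMl// normrX.
exact: exprn_ile1.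
Qed.

(** Integrating [1 + t * X <= expR (t * X)] leaves a quadratic error; small t of both signs then
    force the mean to vanish. *)
Let mean_le (t : R) : `|t| <= 1 -> t * m <= t ^+ 2 * (2 * C).
Proof.
move=> t1; have : \int[P]_w (1 + t * X w) <= \int[P]_w expR (t * X w).
  apply: le_Rintegral => //; last by move=> w _; exact: expR_ge1Dx.
  by apply: iD; [exact: icst|exact: iZ].
rewrite ED//; last exact: iZ.
rewrite Ec EZ// Eexp -/m; have := mgf_ub t1.
have : t ^+ 2 * (v / 2) <= t ^+ 2 * C.
  rewrite ler_wpM2l ?sqr_ge0//; apply: (le_trans (ler_norm _)).
  by rewrite lerDl mulr_ge0 ?sqr_ge0 ?expR_ge0.
have : t ^+ 4 * C <= t ^+ 2 * C.
  rewrite ler_wpM2r// (exprM t 2 2) expr2 ler_piMl ?sqr_ge0//.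
  by rewrite -real_normK ?num_real// exprn_ile1.
lra.
Qed.

Let mean0 : m = 0.
Proof.
have C2 : 0 <= 2 * C by rewrite mulr_ge0.
apply/eqP; rewrite eq_le -[0 <= m]oppr_le0; apply/andP; split.
- apply: (le_of_leD_scale C2) => t /andP[t0 t1]; rewrite add0r.
  have := @mean_le t; rewrite ger0_norm ?(ltW t0)// => /(_ t1).
  by rewrite expr2 -mulrA ler_pM2l.
- apply: (le_of_leD_scale C2) => t /andP[t0 t1]; rewrite add0r.
  have := @mean_le (- t); rewrite normrN ger0_norm ?(ltW t0)// => /(_ t1).
  by rewrite sqrrN mulNr -mulrN expr2 -mulrA ler_pM2l.
Qed.

Let cosh_le (t : R) : 0 < t <= 1 ->
  `|2 * (expR (t ^+ 2 * v / 2) - 1) - t ^+ 2 * s| <= 6 * t ^+ 3 * \int[P]_w W w.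
Proof.
move=> /andP[t0 t1].
have t01 : 0 <= t <= 1 by rewrite ltW.
pose f w := expR (t * X w) + (expR (- t * X w) + (- 2 + - t ^+ 2 * X w ^+ 2)).
have i3 : P.-integrable setT (EFin \o (fun w => - 2 + - t ^+ 2 * X w ^+ 2)).
  by apply: iD; [exact: icst|exact: iZ].
have i2 : P.-integrable setT
    (EFin \o (fun w => expR (- t * X w) + (- 2 + - t ^+ 2 * X w ^+ 2))).
  by apply: iD => //; exact: iexp.
have fi : P.-integrable setT (EFin \o f) by apply: iD => //; exact: iexp.
have Ef : \int[P]_w f w = 2 * (expR (t ^+ 2 * v / 2) - 1) - t ^+ 2 * s.
  rewrite !ED//; first by rewrite !Eexp Ec EZ// sqrrN -/s; lra.
  exact: iZ.
have fW w : `|f w| <= 6 * t ^+ 3 * W w.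
  rewrite (_ : f w = expR (t * X w) + expR (- (t * X w)) - 2 - (t * X w) ^+ 2).
    exact: cosh_approx.
  by rewrite /f exprMn mulNr; ring.
rewrite -Ef -EZ// ler_norml -mulN1r -EZ; last exact: iZ.
apply/andP; split; apply: le_Rintegral => //.
- by apply: iZ; exact: iZ.
- by move=> w _; have := fW w; rewrite ler_norml mulN1r => /andP[].
- exact: iZ.
- by move=> w _; exact: le_trans (ler_norm _) (fW w).
Qed.

(** After division by [t ^+ 2], [cosh_le] and the second-order bounds on the Laplace transform
    differ by O(t), in both directions. *)
Let sqr_mean : s = v.
Proof.
have W0 : 0 <= \int[P]_w W w.
  by apply: Rintegral_ge0 => w _; exact: sqr_ge0.
have D0 : 0 <= 6 * \int[P]_w W w + 2 * C by rewrite addr_ge0 ?mulr_ge0.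
apply/eqP; rewrite eq_le; apply/andP; split; apply: (le_of_leD_scale D0) => t t01.
- have := cosh_le t01; rewrite ler_norml => /andP[h _].
  have /andP[t0 t1] := t01.
  have := @mgf_ub t; rewrite ger0_norm ?(ltW t0)// => /(_ t1) h'.
  have h4 : t ^+ 4 * C <= t ^+ 3 * C.
    by rewrite ler_wpM2r// exprS ler_piMl ?exprn_ge0// ltW.
  have t2 : 0 < t ^+ 2 by rewrite exprn_gt0.
  rewrite -(ler_pM2l t2).
  rewrite [leRHS](_ : _ = t ^+ 2 * v + 6 * t ^+ 3 * \int[P]_w W w
    + 2 * (t ^+ 3 * C)); last by ring.
  lra.
- have := cosh_le t01; rewrite ler_norml => /andP[_ h].
  have /andP[t0 t1] := t01.
  have h' := expR_ge1Dx (t ^+ 2 * v / 2).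
  have t2 : 0 < t ^+ 2 by rewrite exprn_gt0.
  rewrite -(ler_pM2l t2).
  rewrite [leRHS](_ : _ = t ^+ 2 * s + 6 * t ^+ 3 * \int[P]_w W w
    + 2 * (t ^+ 3 * C)); last by ring.
  have : 0 <= t ^+ 3 * C by rewrite mulr_ge0 ?exprn_ge0// ltW.
  lra.
Qed.

Lemma mgf_gaussian_Lfun2 : X \in Lfun P 2%:E.
Proof. exact: X2. Qed.

Lemma mgf_gaussian_variance : variance P X = v%:E.
Proof.
rewrite varianceE//.
have -> : ('E_P[X] = 0)%E.
  rewrite unlock -(@fineK _ (\int[P]_w (X w)%:E)%E); last first.
    exact: integrable_fin_num.
  by rewrite -/(Rintegral P setT X) -/m mean0.
rewrite expe2 mule0 sube0 unlock.
rewrite -(@fineK _ (\int[P]_w ((X ^+ 2) w)%:E)%E); last first.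
  exact: (integrable_fin_num measurableT iX2).
by rewrite -[v in RHS]sqr_mean.
Qed.

End gaussian_moments.

(** * Covariances of the free field *)

Section shifted_density.
Context disp (Omega : measurableType disp) (R : realType) (N : nat).
Variables (P : probability Omega R) (X : Omega -> N.-tuple (measurableTypeR R)).
Variables (U : N.-tuple (measurableTypeR R) -> R) (c : R).
Hypothesis mX : measurable_fun setT X.
Hypothesis mU : measurable_fun setT U.
Hypothesis PE : forall A, measurable A ->
  P (X @^-1` A) = (\int[lebesgue_tuple R N]_(v in A) (c * expR (- U v))%:E)%E.

(** The sign of c is not part of the definition of the field; a negative c would make the total mass
    at most 0 instead of 1. *)
Let c_ge0 : 0 <= c.
Proof.
have PT := probability_setT P; rewrite leNgt; apply/negP => c0.
move: (PE measurableT); rewrite preimage_setT PT => PE1.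
have : (1%:E <= 0 :> \bar R)%E; last by rewrite lee_fin ler10.
rewrite PE1 (eq_integral (fun v => - (- c * expR (- U v))%:E)%E); last first.
  by move=> v _; rewrite -EFinN mulNr opprK.
rewrite integral_ge0N//.
  rewrite oppe_le0 integral_ge0// => v _.
  by rewrite lee_fin mulr_ge0 ?expR_ge0 ?oppr_ge0 ?ltW.
by move=> v _; rewrite lee_fin mulr_ge0 ?expR_ge0 ?oppr_ge0 ?ltW.
Qed.

Let mdensity : measurable_fun setT (fun v => c * expR (- U v)).
Proof.
apply: measurable_funM => //; apply: measurableT_comp => //.
exact: measurableT_comp.
Qed.

(** Multiplied by the density, the integrand becomes the density translated by h, whose total mass
    is still 1. The normalizing constant is never computed. *)
Lemma integral_shifted_density (h : N.-tuple (measurableTypeR R)) :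
  (\int[P]_w (expR (U (X w) - U (tuple_shift h (X w))))%:E = 1)%E.
Proof.
pose f v := expR (U v - U (tuple_shift h v)).
have mf : measurable_fun setT f.
  apply: measurableT_comp => //; apply: measurable_funB => //.
  exact: measurableT_comp (measurable_tuple_shift h).
transitivity (\int[pushforward P X]_v (f v)%:E)%E.
  rewrite ge0_integral_pushforward//.
  - exact/measurable_EFinP.
  - by move=> v _; rewrite lee_fin expR_ge0.
rewrite (@ge0_integral_density _ _ _ (lebesgue_tuple R N) _
  (fun v => c * expR (- U v)))//; last 3 first.
- by move=> v; rewrite mulr_ge0 ?expR_ge0.
- exact/measurable_EFinP.
- by move=> v; rewrite lee_fin expR_ge0.
transitivity (\int[lebesgue_tuple R N]_v
    ((fun v => (c * expR (- U v))%:E) (tuple_shift h v)))%E.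
  apply: eq_integral => v _; rewrite -EFinM mulrCA -expRD.
  by congr (_ * expR _)%:E; ring.
rewrite (ge0_integral_tuple_shift h (f := fun v => (c * expR (- U v))%:E)).
- by rewrite -PE// preimage_setT probability_setT.
- exact/measurable_EFinP.
- by move=> v; rewrite lee_fin mulr_ge0 ?expR_ge0.
Qed.

End shifted_density.

(** * The bilinear form polarizing the Hamiltonian *)

Section gff_form.
Variables (n d : nat) (R : realType) (m : R).
Implicit Types (u v : config n d -> R).

(** The coefficients are twice those of [hamiltonian], so that the form is exactly the cross term in
    [hamiltonianD]. *)
Definition gff_form u v : R :=
  2^-1 * (\sum_(p : config n d * config n d | hamming p.1 p.2 == 1%N)
            (((n - 1) * d)%N%:R)^-1 * ((u p.1 - u p.2) * (v p.1 - v p.2)))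
  + m ^+ 2 * \sum_(x : config n d) u x * v x.

Lemma hamiltonianD u v :
  hamiltonian m (fun x => u x + v x) =
  hamiltonian m u + gff_form u v + hamiltonian m v.
Proof.
rewrite /hamiltonian /gff_form; set a := (((n - 1) * d)%N%:R)^-1.
have -> : \sum_(p : config n d * config n d | hamming p.1 p.2 == 1%N)
      a * (u p.1 + v p.1 - (u p.2 + v p.2)) ^+ 2 =
    \sum_(p : config n d * config n d | hamming p.1 p.2 == 1%N)
      a * (u p.1 - u p.2) ^+ 2
    + 2 * (\sum_(p : config n d * config n d | hamming p.1 p.2 == 1%N)
      a * ((u p.1 - u p.2) * (v p.1 - v p.2)))
    + \sum_(p : config n d * config n d | hamming p.1 p.2 == 1%N)
      a * (v p.1 - v p.2) ^+ 2.
  by rewrite mulr_sumr -!big_split/=; apply: eq_bigr => p _; ring.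
have -> : \sum_x (u x + v x) ^+ 2 =
    \sum_x u x ^+ 2 + 2 * (\sum_x u x * v x) + \sum_x v x ^+ 2.
  by rewrite mulr_sumr -!big_split/=; apply: eq_bigr => x _; ring.
by field.
Qed.

Lemma gff_formDl u v w :
  gff_form (fun x => u x + v x) w = gff_form u w + gff_form v w.
Proof.
rewrite /gff_form addrACA -!mulrDr -!big_split/=.
by congr (_ * _ + _ * _); apply: eq_bigr => p _; ring.
Qed.

Lemma gff_formZl t u v : gff_form (fun x => t * u x) v = t * gff_form u v.
Proof.
rewrite /gff_form mulrDr !(mulrCA t) !(mulr_sumr _ _ _ t).
by congr (_ * _ + _ * _); apply: eq_bigr => p _; ring.
Qed.

Lemma hamiltonianZ t u :
  hamiltonian m (fun x => t * u x) = t ^+ 2 * hamiltonian m u.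
Proof.
rewrite /hamiltonian mulrDr !(mulrCA (t ^+ 2)) !(mulr_sumr _ _ _ (t ^+ 2)).
by congr (_ * _ + _ * _); apply: eq_bigr => p _; ring.
Qed.

Lemma hamiltonianE u : hamiltonian m u = gff_form u u / 2.
Proof.
rewrite /hamiltonian /gff_form mulrDl; congr (_ + _).
  by rewrite mulrAC; congr (_ * _); field.
by rewrite mulrAC.
Qed.

Lemma measurable_hamiltonian :
  measurable_fun setT (fun v : #|{: config n d}|.-tuple (measurableTypeR R) =>
    hamiltonian m (field_of_tuple v)).
Proof.
have mt (x : config n d) : measurable_fun setT
    (fun v : #|{: config n d}|.-tuple (measurableTypeR R) => field_of_tuple v x).
  exact: measurable_tnth.
apply: measurable_funD; apply: measurable_funM => //.
  under eq_fun do rewrite -big_filter.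
  apply: measurable_sum => p; apply: measurable_funM => //.
  by apply: measurable_funX; exact: measurable_funB.
by apply: measurable_sum => x; exact: measurable_funX.
Qed.

Lemma measurable_gff_form disp (T : measurableType disp) u
    (G : config n d -> T -> R) :
  (forall x, measurable_fun setT (G x)) ->
  measurable_fun setT (fun w => gff_form u (fun x => G x w)).
Proof.
move=> mG; apply: measurable_funD; apply: measurable_funM => //.
  under eq_fun do rewrite -big_filter.
  apply: measurable_sum => p; apply: measurable_funM => //.
  by apply: measurable_funM => //; exact: measurable_funB.
by apply: measurable_sum => x; exact: measurable_funM.
Qed.

End gff_form.

(** * From the Laplace transform of the field to its covariances *)

Section gff_covariance.
Context disp (Omega : measurableType disp) (R : realType) (n d : nat).
Variables (m beta : R) (P : probability Omega R).
Variable g : config n d -> {RV P >-> R}.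
Hypothesis beta0 : 0 < beta.
Hypothesis gffg : is_gff m beta g.

Lemma gff_laplace (u : config n d -> R) :
  (\int[P]_w (expR (- beta * gff_form m u (fun x => g x w)))%:E =
   (expR (beta * hamiltonian m u))%:E)%E.
Proof.
have [c PE] := gffg.
pose X w := tuple_of_field (fun x => g x w).
have mX : measurable_fun setT X.
  apply/measurable_fun_tnthP => i.
  rewrite (_ : _ \o _ = g (enum_val i)); last first.
  by apply/funext => w /=; rewrite tnth_mktuple.
  exact: (@measurable_funPT _ _ _ _ (g (enum_val i))).
pose U v := beta * hamiltonian m (@field_of_tuple n d R v).
have mU : measurable_fun setT U.
  by apply: measurable_funM => //; exact: measurable_hamiltonian.
have PE' A : measurable A -> P (X @^-1` A) =
    (\int[lebesgue_tuple R #|{: config n d}|]_(v in A) (c * expR (- U v))%:E)%E.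
  move=> mA; rewrite (PE _ mA); apply: eq_integral => v _.
  by rewrite mulNr.
have := integral_shifted_density mX mU PE' (tuple_of_field u).
have UE w : expR (U (X w) - U (tuple_shift (tuple_of_field u) (X w))) =
    expR (- (beta * hamiltonian m u)) *
    expR (- beta * gff_form m u (fun x => g x w)).
  rewrite -expRD; congr expR; rewrite /U.
  rewrite (_ : field_of_tuple (tuple_shift _ _) =
    fun x => u x + g x w); last first.
    apply/funext => x.
    by rewrite /field_of_tuple !tnth_mktuple enum_rankK addrC.
  by rewrite hamiltonianD /X tuple_of_fieldK; ring.
under eq_integral do rewrite UE EFinM.
rewrite ge0_integralZl//; last first.
  apply/measurable_EFinP; apply: measurableT_comp => //.
  apply: measurable_funM => //; apply: measurable_gff_form => x.
  exact: (@measurable_funPT _ _ _ _ (g x)).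
set I := (\int[P]_w _)%E => h.
rewrite -[LHS]mul1e -[1%E]/(1%:E) -expR0 -(subrr (beta * hamiltonian m u)).
by rewrite expRD EFinM -muleA h mule1.
Qed.

(** With u representing l, [gff_laplace] at [- t * u] is the Laplace transform of a centred Gaussian
    of variance [l u]. Linearity of l is implied by the representation. *)
Lemma gff_variance (u : config n d -> R) (l : (config n d -> R) -> R) :
  (forall v, gff_form m u v = l v / beta) ->
  measurable_fun setT (fun w => l (fun x => g x w)) ->
  (fun w => l (fun x => g x w)) \in Lfun P 2%:E /\
  variance P (fun w => l (fun x => g x w)) = (l u)%:E.
Proof.
move=> uE ml.
have mgf t : (\int[P]_w (expR (t * l (fun x => g x w)))%:E =
    (expR (t ^+ 2 * l u / 2))%:E)%E.
  have := gff_laplace (fun x => - t * u x).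
  rewrite hamiltonianZ sqrrN hamiltonianE uE => h.
  rewrite (_ : t ^+ 2 * l u / 2 = beta * (t ^+ 2 * (l u / beta / 2))); last first.
    by field; rewrite gt_eqF.
  rewrite -h; apply: eq_integral => w _; congr (expR _)%:E.
  by rewrite gff_formZl uE; field; rewrite gt_eqF.
split; first exact: (mgf_gaussian_Lfun2 ml mgf).
exact: (mgf_gaussian_variance ml mgf).
Qed.

(** Polarization: [K x], [K y] and their sum represent the evaluations at x, at y and their sum, and
    the three variances determine the covariance. *)
Lemma gff_covariance (K : config n d -> config n d -> R) :
  (forall x y, K x y = K y x) ->
  (forall x v, gff_form m (K x) v = v x / beta) ->
  forall x y, covariance P (g x) (g y) = (K x y)%:E.
Proof.
move=> Ksym KE x y.
have mg z : measurable_fun setT (g z).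
  exact: (@measurable_funPT _ _ _ _ (g z)).
have [x2 xv] := @gff_variance (K x) (fun v => v x) (KE x) (mg x).
have [y2 yv] := @gff_variance (K y) (fun v => v y) (KE y) (mg y).
have KxyE v : gff_form m (fun z => K x z + K y z) v = (v x + v y) / beta.
  by rewrite gff_formDl !KE mulrDl.
have [xy2 xyv] := @gff_variance (fun z => K x z + K y z) (fun v => v x + v y)
  KxyE (measurable_funD (mg x) (mg y)).
have := varianceD x2 y2; rewrite xyv xv yv.
have Pfin := fin_num_measure P _ measurableT.
(* Finiteness is required before solving for the covariance, which is an extended real. *)
have := covariance_fin_num (Lfun_subset12 Pfin x2) (Lfun_subset12 Pfin y2)
  (Lfun2_mul_Lfun1 x2 y2).
case: (covariance _ _ _) => // r _ [] h.
congr EFin; rewrite (Ksym y x) in h; lra.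
Qed.

End gff_covariance.

(** * Neighbour sums on the Hamming graph *)

Section hamming_neighbours.
Variables (n d : nat).
Implicit Types x y z : config n d.

Lemma hammingC x y : hamming x y = hamming y x.
Proof. by apply: eq_card => i; rewrite !inE eq_sym. Qed.

Lemma hamming_le x y : (hamming x y <= d)%N.
Proof. by rewrite -[leqRHS]card_ord; exact: max_card. Qed.

Lemma hamming_eq0 x y : (hamming x y == 0%N) = (x == y).
Proof.
rewrite cards_eq0; apply/eqP/eqP => [h|->]; last first.
  by apply/setP => i; rewrite !inE eqxx.
apply/ffunP => i; apply/eqP; move/setP: h => /(_ i).
by rewrite !inE => /negbFE.
Qed.

Definition config_upd x (i : 'I_d) (b : 'I_n) : config n d :=
  [ffun j => if j == i then b else x j].

Lemma hamming_sum x y : hamming x y = (\sum_i (x i != y i))%N.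
Proof.
rewrite /hamming -sum1_card big_mkcond; apply: eq_bigr => i _.
by rewrite inE; case: (x i != y i).
Qed.

(** Only the i-th summand of the distance changes; the additive form avoids truncated
    subtraction. *)
Lemma hamming_upd x z i b :
  (hamming (config_upd x i b) z + (x i != z i) = hamming x z + (b != z i))%N.
Proof.
rewrite !hamming_sum (bigD1 i)//= 
  (bigD1 i (F := fun i => nat_of_bool (x i != z i)))//=.
rewrite ffunE eqxx.
rewrite (eq_bigr (fun j => nat_of_bool (x j != z j))).
  by rewrite [RHS](ACl (3*2*1)).
by move=> j /negbTE ji; rewrite ffunE ji.
Qed.

Lemma sum_neighbours (V : nmodType) x (f : config n d -> V) :
  \sum_(y | hamming x y == 1%N) f y =
  \sum_i \sum_(b | b != x i) f (config_upd x i b).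
Proof.
(* The inner sum has exactly one term, the coordinate where a neighbour differs; exchanging the sums
   then groups neighbours by that coordinate. *)
transitivity (\sum_(y | hamming x y == 1%N) \sum_(i | x i != y i) f y).
  apply: eq_bigr => y /eqP h; rewrite sumr_const.
  rewrite (_ : #|_| = 1%N) ?mulr1n// -h; apply: eq_card => i.
  by rewrite !inE.
rewrite (exchange_big_dep xpredT)//=; apply: eq_bigr => i _.
rewrite (reindex_onto (config_upd x i) (fun y => y i))/=; last first.
  move=> y /andP[h xyi]; apply/ffunP => j; rewrite ffunE.
  case: eqVneq => [->//|ji].
  apply/eqP; apply: contraTT h => xyj.
  rewrite hamming_sum (bigD1 i)//= (bigD1 j)//=.
  by rewrite xyi xyj.
apply: eq_bigl => b; rewrite ffunE eqxx eqxx andbT.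
have := hamming_upd x x i b; rewrite hammingC eqxx addn0 => ->.
rewrite (eq_sym b (x i)); case: (x i != b); rewrite ?andbF// andbT addn1 eqSS.
by rewrite hamming_eq0 eqxx.
Qed.

Lemma card_ord_neq (b : 'I_n) : #|[pred c : 'I_n | c != b]| = (n - 1)%N.
Proof.
rewrite -[in RHS](card_ord n) subn1 [in RHS](cardD1 b) inE add1n /=.
by apply: eq_card => c; rewrite !inE andbT.
Qed.

Lemma sum_neighbours_const (V : nmodType) x (c : V) :
  \sum_(y | hamming x y == 1%N) c = c *+ (n - 1) *+ d.
Proof.
rewrite sum_neighbours (eq_bigr (fun=> c *+ (n - 1))).
  by rewrite sumr_const card_ord.
by move=> i _; rewrite sumr_const card_ord_neq.
Qed.

(** At each of the rho differing coordinates one new value lowers the distance and n - 2 keep it; at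
    each agreeing coordinate all n - 1 new values raise it. *)
Lemma sum_neighbours_radial (V : nmodType) (k : nat -> V) x z :
  let rho := hamming x z in
  \sum_(y | hamming x y == 1%N) k (hamming y z) =
  (k rho.-1 + k rho *+ (n - 2)) *+ rho + k rho.+1 *+ (n - 1) *+ (d - rho).
Proof.
move=> rho; rewrite sum_neighbours.
rewrite (bigID (fun i => x i != z i))/=; congr (_ + _).
- rewrite (eq_bigr (fun=> k rho.-1 + k rho *+ (n - 2))) => [|i xzi].
    rewrite sumr_const; congr (_ *+ _).
    by apply: eq_card => i; rewrite !inE.
  rewrite (bigD1 (z i))/=; last by rewrite eq_sym.
  have := hamming_upd x z i (z i); rewrite eqxx xzi addn0 addn1 -/rho => hE.
  rewrite -{1}hE; congr (_ + _); rewrite (eq_bigr (fun=> k rho)); last first.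
    move=> b /andP[_ bzi]; have := hamming_upd x z i b.
    by rewrite bzi xzi -/rho => /eqP; rewrite eqn_add2r => /eqP ->.
  rewrite sumr_const; congr (_ *+ _).
  have nE := card_ord_neq (z i); rewrite (cardD1 (x i)) inE xzi add1n in nE.
  rewrite -[2%N]/(1 + 1)%N subnDA -nE subn1/=; apply: eq_card => b.
  by rewrite !inE.
- rewrite (eq_bigr (fun=> k rho.+1 *+ (n - 1))) => [|i /negPn/eqP xzi].
    rewrite sumr_const; congr (_ *+ _).
    have := cardC [set i | x i != z i]%SET; rewrite card_ord => dE.
    rewrite -[in RHS]dE addKn; apply: eq_card => i.
    by rewrite !inE.
  rewrite (eq_bigr (fun=> k rho.+1)) => [|b bxi].
    by rewrite sumr_const card_ord_neq.
  have := hamming_upd x z i b.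
  by rewrite -xzi bxi eqxx/= addn0 addn1 => ->.
Qed.

End hamming_neighbours.

(** * The form as an operator, applied to radial functions *)

Section gff_form_radial.
Variables (n d : nat) (R : realType) (m : R).
Hypotheses (hn : (2 <= n)%N) (hd : (0 < d)%N).

Let a : R := (((n - 1) * d)%N%:R)^-1.

Let a_def : ((n - 1) * d)%N%:R * a = 1.
Proof. by rewrite mulfV// pnatr_eq0 -lt0n muln_gt0 subn_gt0 hn. Qed.

(** Swapping the ordered pair shows that both halves of the gradient sum equal D, which cancels the
    factor 1/2; each vertex has (n - 1) d neighbours, hence the identity part. *)
Lemma gff_formE (u v : config n d -> R) :
  gff_form m u v =
  \sum_x v x * ((1 + m ^+ 2) * u x - a * \sum_(y | hamming x y == 1%N) u y).
Proof.
pose D := \sum_(p : config n d * config n d | hamming p.1 p.2 == 1%N)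
  a * ((u p.1 - u p.2) * v p.1).
have swapD : \sum_(p : config n d * config n d | hamming p.1 p.2 == 1%N)
    a * ((u p.2 - u p.1) * v p.2) = D.
  have swapK : involutive (fun p : config n d * config n d => (p.2, p.1)).
    by case.
  rewrite /D (reindex_inj (inv_inj swapK))/=.
  by apply: eq_bigl => p; rewrite hammingC.
have DE : D = \sum_x v x * (u x - a * \sum_(y | hamming x y == 1%N) u y).
  rewrite /D -(pair_big_dep xpredT (fun x y => hamming x y == 1%N)
    (fun x y => a * ((u x - u y) * v x)))/=.
  apply: eq_bigr => x _.
  under eq_bigr => y _ do rewrite mulrA [_ * v x]mulrC mulrBr.
  rewrite -mulr_sumr sumrB -!mulr_sumr sum_neighbours_const.
  congr (_ * (_ - _)).
  by rewrite -mulrnA -mulr_natl mulrCA mulrA a_def mul1r.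
rewrite /gff_form -/a.
have -> : \sum_(p : config n d * config n d | hamming p.1 p.2 == 1%N)
    a * ((u p.1 - u p.2) * (v p.1 - v p.2)) = 2 * D.
  rewrite mulr_natl mulr2n -{2}swapD -big_split/=.
  by apply: eq_bigr => p _; ring.
rewrite mulrA mulVf ?mul1r// DE mulr_sumr -big_split/=.
by apply: eq_bigr => x _; ring.
Qed.

(** By [kS] the operator kills the radial function off x, and by [k0] it gives [beta^-1] at x. At
    [rho = d] the value [k d.+1] has coefficient 0. *)
Lemma gff_form_radial (beta : R) (k : nat -> R) :
  (1 + m ^+ 2) * k 0%N - k 1%N = beta^-1 ->
  (forall rho, (0 < rho <= d)%N -> (1 + m ^+ 2) * k rho =
    a * ((k rho.-1 + k rho *+ (n - 2)) *+ rho
         + k rho.+1 *+ (n - 1) *+ (d - rho))) ->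
  forall (x : config n d) v,
    gff_form m (fun y => k (hamming x y)) v = v x / beta.
Proof.
move=> k0 kS x v; rewrite gff_formE (bigD1 x)//= [X in _ + X]big1 ?addr0.
  congr (_ * _); under eq_bigr => y _ do rewrite hammingC.
  rewrite sum_neighbours_radial (_ : hamming x x = 0%N); last first.
    by apply/eqP; rewrite hamming_eq0.
  rewrite mulr0n add0r subn0 -mulrnA -mulr_natl mulrA [a * _]mulrC a_def mul1r.
  exact: k0.
move=> y yx; under eq_bigr => z _ do rewrite hammingC.
rewrite sum_neighbours_radial hammingC -kS ?subrr ?mulr0// hamming_le andbT.
by rewrite lt0n hamming_eq0.
Qed.

End gff_form_radial.

(** * The backward recurrence *)

Section continued_fraction.
Context (R : realType) (N M : R).
Hypotheses (N1 : 1 <= N) (M0 : 0 < M).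
Implicit Types (u r : R) (d k : nat).

Let N0 : 0 < N. Proof. exact: lt_le_trans N1. Qed.

(** With N = n - 1, M = m^2 and u = rho / d, dividing the radial recurrence by k(rho - 1) reads
    [r_rho * step_den u r = u / N], where r is the next ratio. *)
Definition step_den u r := 1 + M - u * (N - 1) / N - (1 - u) * r.

Definition step u r := u / N / step_den u r.

(** The index j counts down from the top, so that the backward recurrence becomes structural: j
    stands for distance d + 1 - j. *)
Fixpoint ratio_rev d j : R :=
  if j is j'.+1 then step ((d - j')%N%:R / d%:R) (ratio_rev d j') else 0.

(* [ratio d k] is the quotient of the covariances at distances [k] and
   [k - 1]; it vanishes for [k = d + 1]. *)
Definition ratio d k := ratio_rev d (d.+1 - k).

Lemma ratioE d k : (k <= d)%N -> ratio d k = step (k%:R / d%:R) (ratio d k.+1).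
Proof. by move=> kd; rewrite /ratio subSS subSn//= subKn. Qed.

Lemma step_den_ge u r : 0 <= u <= 1 -> 0 <= r <= 1 -> M + u / N <= step_den u r.
Proof.
move=> /andP[u0 u1] /andP[r0 r1].
have -> : step_den u r = M + u / N + (1 - u) * (1 - r).
  by rewrite /step_den; field; rewrite gt_eqF.
by rewrite lerDl mulr_ge0// subr_ge0.
Qed.

Lemma step_den_gt0 u r : 0 <= u <= 1 -> 0 <= r <= 1 -> 0 < step_den u r.
Proof.
move=> u01 r01; apply: lt_le_trans (step_den_ge u01 r01).
by rewrite ltr_wpDr// divr_ge0 ?(ltW N0)//; case/andP: u01.
Qed.

Lemma step_den_le u r : 0 <= u <= 1 -> 0 <= r -> step_den u r <= 1 + M.
Proof.
move=> /andP[u0 u1] r0; rewrite /step_den -addrA gerDl -opprD oppr_le0.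
by rewrite addr_ge0// ?mulr_ge0 ?invr_ge0 ?(ltW N0) ?subr_ge0.
Qed.

Lemma step_ge u r : 0 <= u <= 1 -> 0 <= r <= 1 -> u / N / (1 + M) <= step u r.
Proof.
move=> u01 r01; have /andP[u0 _] := u01; have /andP[r0 _] := r01.
rewrite ler_wpM2l ?divr_ge0 ?(ltW N0)// lef_pV2 ?posrE ?step_den_gt0//.
  exact: step_den_le.
by rewrite addr_gt0.
Qed.

Lemma step_ge0 u r : 0 <= u <= 1 -> 0 <= r <= 1 -> 0 <= step u r.
Proof.
move=> u01 r01; apply: le_trans (step_ge u01 r01); have /andP[u0 _] := u01.
by rewrite !mulr_ge0 ?invr_ge0 ?(ltW N0) ?addr_ge0 ?(ltW M0).
Qed.

Lemma step_le u r : 0 <= u <= 1 -> 0 <= r <= 1 -> step u r <= (1 + M)^-1.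
Proof.
move=> u01 r01; have /andP[u0 u1] := u01.
have uN1 : u / N <= 1 by rewrite ler_pdivrMr// mul1r (le_trans u1).
have uN0 : 0 <= u / N by rewrite divr_ge0 ?(ltW N0).
have MuN : 0 < M + u / N by rewrite ltr_wpDr.
apply: (@le_trans _ _ (u / N / (M + u / N))).
  by rewrite ler_wpM2l// lef_pV2 ?posrE ?step_den_gt0// step_den_ge.
rewrite ler_pdivrMr// ler_pdivlMl ?addr_gt0//.
by rewrite mulrDl mul1r addrC lerD2r ler_piMr// ltW.
Qed.

Lemma step_le_lin u r : 0 <= u <= 1 -> 0 <= r <= 1 -> step u r <= u / M.
Proof.
move=> u01 r01; have /andP[u0 u1] := u01.
have uN0 : 0 <= u / N by rewrite divr_ge0 ?(ltW N0).
rewrite /step; apply: ler_pM => //.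
- by rewrite invr_ge0 ltW// step_den_gt0.
- by rewrite ler_pdivrMr// ler_peMr.
- rewrite lef_pV2 ?posrE ?step_den_gt0//; apply: le_trans (step_den_ge u01 r01).
  by rewrite lerDl.
Qed.

Let M1 : (1 + M)^-1 <= 1.
Proof. by rewrite invf_le1 ?addr_gt0// lerDl ltW. Qed.

Lemma step_homo u u' r r' : 0 <= u -> u <= u' -> u' <= 1 ->
  0 <= r -> r <= r' -> r' <= 1 -> step u r <= step u' r'.
Proof.
move=> u0 uu' u'1 r0 rr' r'1.
have u01 : 0 <= u <= 1 by rewrite u0 (le_trans uu').
have u'01 : 0 <= u' <= 1 by rewrite u'1 (le_trans u0).
have r01 : 0 <= r <= 1 by rewrite r0 (le_trans rr').
have r'01 : 0 <= r' <= 1 by rewrite r'1 (le_trans r0).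
have D0 := step_den_gt0 u01 r01; have D'0 := step_den_gt0 u'01 r'01.
rewrite /step -!mulrA (mulrCA u) (mulrCA u') ler_wpM2l ?invr_ge0 ?(ltW N0)//.
rewrite ler_pdivrMr// mulrAC ler_pdivlMr//.
rewrite /step_den.
have -> : u * (1 + M - u' * (N - 1) / N - (1 - u') * r') =
  u * (1 + M - r') - u * u' * ((N - 1) / N - r') by ring.
have -> : u' * (1 + M - u * (N - 1) / N - (1 - u) * r) =
  u' * (1 + M - r) - u * u' * ((N - 1) / N - r) by ring.
(* The terms in [(N - 1) / N] cancel: the difference of the two sides is [(u' - u) * (1 + M - r) + u
   * (1 - u') * (r' - r)]. *)
have h1 : u * (1 + M - r) <= u' * (1 + M - r).
  by rewrite ler_wpM2r// subr_ge0 (le_trans (le_trans rr' r'1))// lerDl ltW.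
have h2 : 0 <= u * (1 - u') * (r' - r).
  by rewrite !mulr_ge0// subr_ge0.
nra.
Qed.

Lemma frac_itv d k : (k <= d)%N -> 0 <= (k%:R / d%:R : R) <= 1.
Proof.
move=> kd; rewrite divr_ge0//=; case: d kd => [|d] kd.
  by rewrite invr0 mulr0.
by rewrite ler_pdivrMr// mul1r ler_nat.
Qed.

Lemma ratio_rev_itv d j : (j <= d.+1)%N -> 0 <= ratio_rev d j <= (1 + M)^-1.
Proof.
elim: j => [_|j IH jd]; first by rewrite lexx/= invr_ge0 addr_ge0 ?(ltW M0).
have /andP[h0 h1] := IH (ltnW jd).
have r01 : 0 <= ratio_rev d j <= 1 by rewrite h0 (le_trans h1).
have u01 := frac_itv (leq_subr j d).
by rewrite /= step_ge0// step_le.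
Qed.

Lemma ratio_ge0 d k : 0 <= ratio d k.
Proof. by have /andP[] := ratio_rev_itv (leq_subr k d.+1). Qed.

Lemma ratio_le d k : ratio d k <= (1 + M)^-1.
Proof. by have /andP[] := ratio_rev_itv (leq_subr k d.+1). Qed.

Lemma ratio_itv d k : 0 <= ratio d k <= 1.
Proof. by rewrite ratio_ge0 (le_trans (ratio_le d k)). Qed.

Lemma ratio_ge d k : (k <= d)%N -> k%:R / d%:R / N / (1 + M) <= ratio d k.
Proof. by move=> kd; rewrite ratioE// step_ge ?frac_itv ?ratio_itv. Qed.

Lemma ratio_gt0 d k : (0 < k <= d)%N -> 0 < ratio d k.
Proof.
move=> /andP[k0 kd]; apply: lt_le_trans (ratio_ge kd).
by rewrite !divr_gt0 ?addr_gt0 ?ltr0n// (leq_trans k0).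
Qed.

(* Enlarging [d] at a fixed (or smaller) proportion [k / d] decreases the ratio,
   since one step of the backward recursion moves [k / d] by [1 / d] only. *)
Lemma ratio_homo d d' k k' : (0 < d' <= d)%N -> (k <= d)%N -> (k' <= d')%N ->
  (k * d' <= k' * d)%N -> ratio d k <= ratio d' k'.
Proof.
move=> /andP[d'0 d'd].
have d0 : (0 < d)%N by exact: leq_trans d'd.
move: {2}(d' - k')%N (erefl (d' - k')%N) => e.
elim: e k k' => [|e IH] k k' ek kd kd' kk'.
  have -> : k' = d' by apply/eqP; rewrite eqn_leq kd' -subn_eq0 ek.
  rewrite ratioE// (ratioE (leqnn d')) divff ?pnatr_eq0 -?lt0n//.
  have /andP[u0 u1] := frac_itv kd; have /andP[r0 r1] := ratio_itv d k.+1.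
  (* At [u = 1] the value of [step] no longer depends on the next ratio. *)
  apply: (@le_trans _ _ (step 1 (ratio d k.+1))).
    exact: step_homo.
  by rewrite /step /step_den subrr !mul0r.
have k'd' : (k' < d')%N by rewrite -subn_gt0 ek.
have kd1 : (k < d)%N.
  rewrite ltnNge; apply/negP => dk; move: kk'; apply/negP; rewrite -ltnNge.
  apply: (@leq_trans (d' * d)%N); first by rewrite ltn_pmul2r.
  by rewrite mulnC leq_mul2r dk orbT.
rewrite ratioE// (ratioE kd').
have /andP[u0 _] := frac_itv kd; have /andP[_ u1] := frac_itv kd'.
have /andP[r0 _] := ratio_itv d k.+1; have /andP[_ r1] := ratio_itv d' k'.+1.
apply: step_homo => //.
  by rewrite ler_pdivrMr ?ltr0n// mulrAC ler_pdivlMr ?ltr0n// -!natrM ler_nat.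
apply: IH => //; first by rewrite subnS ek.
(* Raising both indices adds d' on the left and d on the right, and [d' <= d]. *)
by rewrite !mulSn leq_add.
Qed.

End continued_fraction.

(** * The decay rate *)

Section decay_rate.
Context (R : realType) (N M : R).
Hypotheses (N1 : 1 <= N) (M0 : 0 < M).
Implicit Types (sigma tau eps C : R) (d k : nat).

Let N0 : 0 < N. Proof. exact: lt_le_trans N1. Qed.

Let lnM0 : 0 < ln (1 + M).
Proof. by rewrite ln_gt0// ltrDl. Qed.

Definition log_ratio d k : R := - ln (ratio N M d k).

Definition log_sum d k : R := \sum_(j < k) log_ratio d j.+1.

Lemma log_ratio_ge d k : (0 < k <= d)%N -> ln (1 + M) <= log_ratio d k.
Proof.
move=> kd; rewrite /log_ratio lerNr -lnV ?posrE ?addr_gt0//.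
by rewrite ler_ln ?posrE ?ratio_gt0 ?invr_gt0 ?addr_gt0// ratio_le.
Qed.

(** This bound is unbounded for small k / d, but by [sum_ln_ge] its sum over k is only O(d). *)
Lemma log_ratio_le d k : (0 < k <= d)%N ->
  log_ratio d k <= ln (N * (1 + M)) + ln d%:R - ln k%:R.
Proof.
move=> /andP[k0 kd]; have d0 : (0 < d)%N by exact: leq_trans kd.
have k0' : 0 < k%:R :> R by rewrite ltr0n.
have d0' : 0 < d%:R :> R by rewrite ltr0n.
have M1 : 0 < 1 + M by rewrite addr_gt0.
rewrite /log_ratio lerNl.
have -> : - (ln (N * (1 + M)) + ln d%:R - ln k%:R) =
    ln (k%:R / d%:R / N / (1 + M)).
  rewrite !lnM ?posrE ?divr_gt0 ?invr_gt0// !lnV ?posrE//.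
  lra.
rewrite ler_ln ?posrE ?ratio_gt0 ?k0// ?divr_gt0//.
exact: ratio_ge.
Qed.

Lemma log_sumS d k : log_sum d k.+1 = log_sum d k + log_ratio d k.+1.
Proof. by rewrite /log_sum big_ord_recr. Qed.

Lemma log_sum_incr d j k : (j <= k <= d)%N ->
  log_sum d j + ln (1 + M) * (k%:R - j%:R) <= log_sum d k.
Proof.
elim: k => [|k IH] /andP[jk kd].
  by move: jk; rewrite leqn0 => /eqP ->; rewrite subrr mulr0 addr0.
move: jk; rewrite leq_eqVlt => /predU1P[->|jk].
  by rewrite subrr mulr0 addr0.
have := IH; rewrite -ltnS jk (ltnW kd) => /(_ isT) h.
rewrite log_sumS; have := @log_ratio_ge d k.+1; rewrite kd => /(_ isT).
rewrite -natr1; lra.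
Qed.

Lemma log_sum_le_nat d j k : (j <= k <= d)%N -> log_sum d j <= log_sum d k.
Proof.
move=> jk; apply: le_trans (log_sum_incr jk).
by rewrite lerDl mulr_ge0 ?(ltW lnM0)// subr_ge0 ler_nat; case/andP: jk.
Qed.

(* Stirling's lower bound [d! >= (d / e) ^ d]. *)
Lemma sum_ln_ge d : d%:R * ln d%:R - d%:R <= \sum_(j < d) ln (j.+1%:R) :> R.
Proof.
elim: d => [|[|d] IH]; first by rewrite big_ord0 mul0r subr0.
  by rewrite big_ord1 ln1; lra.
rewrite big_ord_recr/=; move: IH; set S := \sum_(_ < _) _ => IH.
have d0 : 0 < d.+1%:R :> R by rewrite ltr0n.
have : ln (d.+2%:R / d.+1%:R) <= d.+2%:R / d.+1%:R - 1 :> R.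
  rewrite lerBrDl; apply: (le_trans (expR_ge1Dx _)).
  by rewrite lnK// posrE divr_gt0.
rewrite lnM ?posrE ?ltr0n ?invr_gt0// lnV ?posrE ?ltr0n//.
rewrite -(ler_pM2l d0).
have -> : d.+1%:R * (d.+2%:R / d.+1%:R - 1) = 1 :> R.
  by rewrite -[d.+2%:R]natr1; field; rewrite gt_eqF.
set l2 := ln d.+2%:R; rewrite -[d.+2%:R]natr1; lra.
Qed.

Let K := ln (N * (1 + M)) + 1.

Lemma log_sum_le d k : (k <= d)%N -> log_sum d k <= d%:R * K.
Proof.
move=> kd; apply: (@le_trans _ _ (log_sum d d)).
  by apply: log_sum_le_nat; rewrite kd leqnn.
apply: (@le_trans _ _ (\sum_(j < d) (ln (N * (1 + M)) + ln d%:R - ln j.+1%:R))).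
  by apply: ler_sum => j _; apply: log_ratio_le; rewrite ltn_ord.
rewrite sumrB sumr_const card_ord -[X in X - _]mulr_natl.
have := sum_ln_ge d; rewrite /K; lra.
Qed.

(** As a supremum it bounds the normalized sums for every d; [rate_lim] shows that it is also their
    limit. *)
Definition rate sigma : R :=
  sup [set log_sum d (Num.truncn (sigma * d%:R)) / d%:R
      | d in [set d | (0 < d)%N]].

Lemma truncn_scale_le sigma d :
  sigma <= 1 -> (Num.truncn (sigma * d%:R) <= d)%N.
Proof.
move=> s1; rewrite truncn_le_nat; apply: (@le_lt_trans _ _ d%:R).
  by rewrite ler_piMl.
by rewrite ltr_nat.
Qed.

Let rate_has_sup sigma : sigma <= 1 ->
  has_sup [set log_sum d (Num.truncn (sigma * d%:R)) / d%:R
          | d in [set d | (0 < d)%N]].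
Proof.
move=> s1; split.
  by exists (log_sum 1 (Num.truncn (sigma * 1%:R)) / 1%:R); exists 1%N.
exists K => _ [d /= d0 <-]; rewrite ler_pdivrMr ?ltr0n// [leRHS]mulrC.
by apply: log_sum_le; exact: truncn_scale_le.
Qed.

Lemma rate_ub sigma d : sigma <= 1 -> (0 < d)%N ->
  log_sum d (Num.truncn (sigma * d%:R)) <= rate sigma * d%:R.
Proof.
move=> s1 d0; rewrite -ler_pdivrMr ?ltr0n//.
by apply: ub_le_sup; [exact: (rate_has_sup s1).2|exists d].
Qed.

(* The [q = d / d0] consecutive ratios of dimension [d] with index in
   [(q j, q j + q]] are dominated by the single ratio [j + 1] of dimension [d0]. *)
Lemma log_sum_block d0 d k : (0 < d0 <= d)%N -> (k <= d0)%N ->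
  (d %/ d0)%:R * log_sum d0 k <= log_sum d (d %/ d0 * k).
Proof.
move=> d0d; have /andP[d00 d0d'] := d0d; set q := (d %/ d0)%N.
elim: k => [_|k IH kd]; first by rewrite muln0 /log_sum !big_ord0 mulr0.
have block l : (l <= q)%N ->
    log_sum d (q * k) + l%:R * log_ratio d0 k.+1 <= log_sum d (q * k + l).
  elim: l => [_|l IHl lq]; first by rewrite mul0r addr0 addn0.
  rewrite addnS log_sumS -natr1 mulrDl mul1r addrA.
  apply: lerD; first exact/IHl/ltnW.
  have qd : ((q * k + l).+1 * d0 <= k.+1 * d)%N.
    apply: (@leq_trans (q * k.+1 * d0)%N); last first.
      by rewrite (mulnC q) -mulnA leq_mul2l (leq_trunc_div d d0) orbT.
    by rewrite leq_mul2r mulnS addnC -addSn leq_add2r lq orbT.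
  have qkd : ((q * k + l).+1 <= d)%N.
    rewrite -(leq_pmul2r d00); apply: (leq_trans qd).
    by rewrite mulnC leq_mul2l kd orbT.
  rewrite lerN2 ler_ln ?posrE.
  - exact: ratio_homo.
  - exact: ratio_gt0.
  - by apply: ratio_gt0.
rewrite log_sumS mulrDr mulnS addnC.
by apply: le_trans (block q (leqnn q)); rewrite lerD2r IH// ltnW.
Qed.

(** A Fekete-type argument: a fixed d0 attaining the supremum up to [eps / 2] is repeated in blocks
    of length [d %/ d0] by [log_sum_block]. *)
Lemma rate_lim sigma eps : 0 <= sigma <= 1 -> 0 < eps ->
  exists D, forall d, (D <= d)%N ->
    (rate sigma - eps) * d%:R <= log_sum d (Num.truncn (sigma * d%:R)).
Proof.
move=> /andP[s0 s1] e0.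
have [_ [d0 /= d00 <-]] :=
  sup_adherent (divr_gt0 e0 (ltr0n R 2)) (rate_has_sup s1).
rewrite -/(rate sigma); set k := Num.truncn _ => hk.
set s := log_sum d0 k in hk.
have d00' : 0 < d0%:R :> R by rewrite ltr0n.
have kd0 : (k <= d0)%N by exact: truncn_scale_le.
have s_ge0 : 0 <= s.
  by have := @log_sum_le_nat d0 0 k; rewrite kd0 /log_sum big_ord0 => /(_ isT).
(* Rounding [d / d0] down loses at most s, which is then at most [eps / 2 * d]. *)
exists (maxn d0 (Num.bound (2 * s / eps))) => d.
rewrite geq_max => /andP[d0d Dd].
have d0' : (0 < d)%N by exact: leq_trans d0d.
have d0'' : 0 < d%:R :> R by rewrite ltr0n.
have sd : s <= eps / 2 * d%:R.
  have : 2 * s / eps < d%:R.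
    apply: lt_le_trans (archi_boundP _) _; last by rewrite ler_nat.
    by rewrite divr_ge0 ?mulr_ge0// ltW.
  rewrite ltr_pdivrMr//; lra.
set q := (d %/ d0)%N.
have qk : (q * k <= Num.truncn (sigma * d%:R))%N.
  rewrite truncn_ge_nat ?mulr_ge0// natrM.
  apply: (@le_trans _ _ (q%:R * (sigma * d0%:R))).
    by rewrite ler_wpM2l// truncn_le mulr_ge0.
  by rewrite mulrCA ler_wpM2l// -natrM ler_nat (leq_trunc_div d d0).
have hq : d%:R / d0%:R <= q%:R + 1 :> R.
  by rewrite ler_pdivrMr// natr1 -natrM ler_nat ltnW// ltn_ceil.
have h1 : q%:R * s <= log_sum d (Num.truncn (sigma * d%:R)).
  apply: (@le_trans _ _ (log_sum d (q * k))).
    by apply: log_sum_block; rewrite ?d00.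
  by apply: log_sum_le_nat; rewrite qk truncn_scale_le.
apply: le_trans h1.
have h2 : d%:R / d0%:R * s <= (q%:R + 1) * s by rewrite ler_wpM2r.
have h3 : (rate sigma - eps / 2) * d%:R <= s / d0%:R * d%:R.
  by rewrite ler_wpM2r// ltW.
have h4 : s / d0%:R * d%:R = d%:R / d0%:R * s by ring.
rewrite h4 in h3; lra.
Qed.

(** Each index between [sigma * d] and [tau * d] contributes at least [ln (1 + M)]. Truncation loses
    at most one index, negligible after division by d. *)
Lemma rate_incr sigma tau : 0 <= sigma -> sigma <= tau -> tau <= 1 ->
  rate sigma + ln (1 + M) * (tau - sigma) <= rate tau.
Proof.
move=> s0 st t1; apply/ler_addgt0Pr => e e0.
have [|D hD] := @rate_lim sigma (e / 2) _ (divr_gt0 e0 (ltr0n R 2)).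
  by rewrite s0 (le_trans st).
pose d := (maxn 1 (maxn D (Num.bound (2 * ln (1 + M) / e)))).
have Dd : (D <= d)%N by rewrite !leq_max leqnn orbT.
have d0 : (0 < d)%N by rewrite leq_max.
have d0' : 0 < d%:R :> R by rewrite ltr0n.
have cd : ln (1 + M) <= e / 2 * d%:R.
  have : 2 * ln (1 + M) / e < d%:R.
    apply: lt_le_trans (archi_boundP _) _; last first.
      by rewrite ler_nat !leq_max leqnn !orbT.
    by rewrite divr_ge0 ?mulr_ge0// ltW.
  rewrite ltr_pdivrMr//; lra.
have t0 : 0 <= tau by exact: le_trans st.
have h1 := hD _ Dd; have h2 := rate_ub t1 d0.
have h3 : log_sum d (Num.truncn (sigma * d%:R)) + ln (1 + M) *
    ((Num.truncn (tau * d%:R))%:R - (Num.truncn (sigma * d%:R))%:R)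
    <= log_sum d (Num.truncn (tau * d%:R)).
  apply: log_sum_incr; rewrite truncn_scale_le// andbT.
  by apply: le_truncn; rewrite ler_wpM2r.
have h4 : (Num.truncn (sigma * d%:R))%:R <= sigma * d%:R :> R.
  by rewrite truncn_le mulr_ge0.
have h5 := truncnS_gt (tau * d%:R); rewrite -natr1 in h5.
have h6 : ln (1 + M) * (tau * d%:R - 1 - sigma * d%:R) <=
  ln (1 + M) * ((Num.truncn (tau * d%:R))%:R - (Num.truncn (sigma * d%:R))%:R).
  by rewrite ler_wpM2l ?(ltW lnM0)//; lra.
rewrite -(ler_pM2r d0'); lra.
Qed.

Lemma rate_ge sigma : 0 <= sigma <= 1 -> ln (1 + M) * sigma <= rate sigma.
Proof.
move=> /andP[s0 s1]; have := rate_incr (lexx 0) s0 s1.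
have := @rate_ub 0 1 ler01 isT.
by rewrite mul0r truncn0 /log_sum big_ord0 mulr1; lra.
Qed.

Lemma ln_nat_small A eps : 0 < eps ->
  exists D, forall d, (D <= d)%N -> A + ln d%:R <= eps * d%:R.
Proof.
(* Since [(ln d) ^ 2 <= 2 d], the inequality [ln d > eps / 2 * d] would give [eps ^ 2 * d < 8]. *)
move=> e0; exists (maxn 1 (maxn (Num.bound (8 / eps ^+ 2))
  (Num.bound (2 * `|A| / eps)))).
move=> d; rewrite !geq_max => /and3P[d1 Bd Cd].
have d1' : 1 <= d%:R :> R by rewrite ler1n.
have d0 : 0 < d%:R :> R by rewrite ltr0n.
have hA : A <= eps / 2 * d%:R.
  apply: (le_trans (ler_norm _)).
  have : 2 * `|A| / eps < d%:R.
    apply: lt_le_trans (archi_boundP _) _; last by rewrite ler_nat.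
    by rewrite divr_ge0 ?mulr_ge0// ltW.
  rewrite ltr_pdivrMr//; lra.
have hB : 8 <= eps ^+ 2 * d%:R.
  have : 8 / eps ^+ 2 < d%:R.
    apply: lt_le_trans (archi_boundP _) _; last by rewrite ler_nat.
    by rewrite divr_ge0 ?exprn_ge0// ltW.
  rewrite ltr_pdivrMr ?exprn_gt0//; lra.
have l0 : 0 <= ln d%:R :> R by rewrite ln_ge0.
have := expR_sqr_le l0; rewrite lnK ?posrE// => l2.
suff : ln d%:R <= eps / 2 * d%:R by lra.
rewrite leNgt; apply/negP => h.
have h0 : 0 <= eps / 2 * d%:R by rewrite !mulr_ge0 ?invr_ge0// ltW.
have : (eps / 2 * d%:R) ^+ 2 < ln d%:R ^+ 2 by rewrite ltr_pXn2r ?nnegrE.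
have : 8 * d%:R <= eps ^+ 2 * d%:R * d%:R by rewrite ler_wpM2r// ltW.
have -> : (eps / 2 * d%:R) ^+ 2 = eps ^+ 2 * d%:R * d%:R / 4 by field.
lra.
Qed.

(** A distance within 1 of [sigma * d] is the truncation t or t + 1, and the possible extra term is
    O(ln d). The constant C makes room for a bounded prefactor. *)
Lemma log_sum_asymp sigma eps C : 0 <= sigma <= 1 -> 0 < eps ->
  exists D, forall d, (D <= d)%N -> forall rho, (rho <= d)%N ->
    `|rho%:R - sigma * d%:R| < 1 ->
    (rate sigma - eps) * d%:R + C <= log_sum d rho <= (rate sigma + eps) * d%:R - C.
Proof.
move=> s01 e0; have /andP[s0 s1] := s01.
have e20 : 0 < eps / 2 by rewrite divr_gt0.
have [D1 h1] := rate_lim s01 e20.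
have [D2 h2] := ln_nat_small C e20.
have [D3 h3] := ln_nat_small (C + ln (N * (1 + M))) e0.
exists (maxn 1 (maxn D1 (maxn D2 D3))) => d.
rewrite !geq_max => /and4P[d0 /h1{}h1 /h2{}h2 /h3{}h3] rho rhod.
rewrite ltr_norml => /andP[hl hu].
set t := Num.truncn _ in h1.
have lnd0 : 0 <= ln d%:R :> R by rewrite ln_ge0 ?ler1n.
have ht := truncn_itv (mulr_ge0 s0 (ler0n R d)); rewrite -/t -natr1 in ht.
have /andP[tl tu] := ht.
have trho : (t <= rho)%N by rewrite -ltnS -(ltr_nat R) -natr1; lra.
have rhot : (rho <= t.+1)%N by rewrite -ltnS -(ltr_nat R) -!natr1; lra.
have h4 := rate_ub s1 d0; rewrite -/t in h4.
apply/andP; split.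
  have := @log_sum_le_nat d t rho; rewrite trho rhod => /(_ isT); lra.
have NM0 : 0 <= ln (N * (1 + M)).
  by rewrite ln_ge0// mulr_ege1// lerDl ltW.
move: rhot; rewrite leq_eqVlt ltnS => /predU1P[rhoE|rhot].
  rewrite rhoE in rhod *.
  have := @log_ratio_le d t.+1; rewrite rhod => /(_ isT).
  have : 0 <= ln t.+1%:R :> R by rewrite ln_ge0// ler1n.
  rewrite log_sumS; lra.
have -> : rho = t by apply/eqP; rewrite eqn_leq rhot.
lra.
Qed.

End decay_rate.

(** * The Green function *)

Lemma prod_near1 (R : realType) (x : nat -> R) (C t : R) k :
  0 <= t <= 1 -> 0 <= C ->
  (forall j, (j < k)%N -> 1 <= x j <= 1 + t * C) ->
  1 <= \prod_(j < k) x j <= 1 + t * ((1 + C) ^+ k - 1).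
Proof.
move=> /andP[t0 t1] C0; elim: k => [_|k IH h].
  by rewrite big_ord0 expr0 subrr mulr0 addr0 lexx.
rewrite big_ord_recr/=.
have /andP[p1 p2] := IH (fun j jk => h j (ltnW jk)).
have /andP[x1 x2] := h k (ltnSn k).
apply/andP; split; first exact: mulr_ege1.
have A0 : 0 <= (1 + C) ^+ k - 1 by rewrite subr_ge0 exprn_ege1// lerDl.
rewrite exprS; move: A0 p2; set A := (1 + C) ^+ k => A0 p2.
apply: (@le_trans _ _ ((1 + t * (A - 1)) * (1 + t * C))).
  by rewrite ler_pM// (le_trans ler01).
have : t * (t * (C * (A - 1))) <= t * (C * (A - 1)).
  by rewrite ler_piMl// !mulr_ge0.
lra.
Qed.

Section green_function.
Context (R : realType) (n : nat) (m beta : R).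
Hypotheses (hn : (2 <= n)%N) (hm : 0 < m) (hbeta : 0 < beta).

Let N : R := (n - 1)%N%:R.
Let M : R := m ^+ 2.

Let N1 : 1 <= N. Proof. by rewrite /N ler1n subn_gt0. Qed.
Let N0 : 0 < N. Proof. exact: lt_le_trans N1. Qed.
Let M0 : 0 < M. Proof. exact: exprn_gt0. Qed.
Let M1 : 0 < 1 + M. Proof. by rewrite addr_gt0. Qed.

Definition green_den d k : R := step_den N M (k%:R / d%:R) (ratio N M d k.+1).

Let den_gt0 d k : (k <= d)%N -> 0 < green_den d k.
Proof. by move=> kd; apply: step_den_gt0; rewrite ?frac_itv ?ratio_itv. Qed.

Let den_le d k : (k <= d)%N -> green_den d k <= 1 + M.
Proof. by move=> kd; apply: step_den_le; rewrite ?frac_itv ?ratio_ge0. Qed.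

(** The prefactor is forced by the equation at distance 0, because [green_den d 0] is 1 + M minus
    the first ratio. *)
Definition green d k : R :=
  (beta * green_den d 0)^-1 * \prod_(j < k) ratio N M d j.+1.

Lemma greenS d k : green d k.+1 = green d k * ratio N M d k.+1.
Proof. by rewrite /green big_ord_recr mulrA. Qed.

Lemma green_eq0 d : (1 + M) * green d 0 - green d 1 = beta^-1.
Proof.
rewrite greenS /green big_ord0 mulr1 invfM.
have := den_gt0 (leq0n d).
rewrite /green_den mul0r /step_den !mul0r subr0 subr0 mul1r.
by set r := ratio _ _ _ _ => r0; field; rewrite !gt_eqF.
Qed.

Lemma green_eqS d k : (0 < k <= d)%N ->
  (1 + M) * green d k = (((n - 1) * d)%N%:R)^-1 *
    ((green d k.-1 + green d k *+ (n - 2)) *+ k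
     + green d k.+1 *+ (n - 1) *+ (d - k)).
Proof.
case: k => // k kd; have d0 : 0 < d%:R :> R by rewrite ltr0n (leq_trans _ kd).
rewrite !greenS succnK; set g := green d k; set r' := ratio N M d k.+2.
have rE : ratio N M d k.+1 * green_den d k.+1 = k.+1%:R / d%:R / N.
  by rewrite ratioE// /step -/(green_den d k.+1) divfK// gt_eqF// den_gt0.
move: rE; rewrite /green_den /step_den -/r'; set r := ratio _ _ _ _ => rE.
rewrite natrM -/N -[_ *+ (d - _)]mulr_natl -[_ *+ (n - 1)]mulr_natl.
rewrite -[_ *+ k.+1]mulr_natl -[_ *+ (n - 2)]mulr_natl (natrB _ kd).
rewrite (_ : (n - 2)%N%:R = N - 1); last first.
  by rewrite /N; case: n hn => [|[|p]]// _; rewrite !subSS !subn0 -natr1 addrK.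
move: rE; rewrite -/N; set u := k.+1%:R => rE.
rewrite (_ : _^-1 * _ = g * (u / d%:R / N
    + r * (u / d%:R) * (N - 1) / N + r * r' * (1 - u / d%:R))).
  by rewrite -rE; ring.
by field; rewrite !gt_eqF.
Qed.

Lemma covariance_gff disp (Omega : measurableType disp)
    (P : probability Omega R) d (g : config n d -> {RV P >-> R}) :
  (0 < d)%N -> is_gff m beta g ->
  forall x y, covariance P (g x) (g y) = (green d (hamming x y))%:E.
Proof.
move=> d0 hg.
apply: (gff_covariance hbeta hg (K := fun x y => green d (hamming x y))).
  by move=> x y; rewrite hammingC.
move=> x v; apply: gff_form_radial => //; first exact: green_eq0.
exact: green_eqS.
Qed.

Let expR_natN_ln k (X : R) : 0 < X -> expR (- k%:R * ln X) = (X ^+ k)^-1.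
Proof. by move=> X0; rewrite mulNr expRN expRM_natl lnK. Qed.

(** The ratio at j is [j / ((n - 1) d)] over its denominator; the numerators give the factorial and
    the power of (n - 1) d. The prefactor supplies the denominator of index 0, hence k + 1
    factors. *)
Lemma green_expansion d k : (0 < d)%N -> (k <= d)%N ->
  green d k = k`!%:R / (beta * (1 + M) ^+ k.+1)
    * expR (- k%:R * ln (((n - 1) * d)%N%:R))
    * \prod_(j < k.+1) ((1 + M) / green_den d j).
Proof.
move=> d0 kd.
have d0' : 0 < d%:R :> R by rewrite ltr0n.
have Nd0 : 0 < ((n - 1) * d)%N%:R :> R by rewrite natrM mulr_gt0.
elim: k kd => [_|k IH kd].
  rewrite /green big_ord0 big_ord1 expR_natN_ln// expr0 fact0 expr1.
  have := den_gt0 (leq0n d); set D := green_den d 0 => D0.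
  by field; rewrite !gt_eqF.
rewrite greenS (IH (ltnW kd)) ratioE// /step -/(green_den d k.+1).
rewrite [in RHS]big_ord_recr/= !expR_natN_ln// natrM -/N factS natrM.
have := den_gt0 kd; set D := green_den d k.+1 => D0; set Q := \prod_(_ < _) _.
have Xk : (N * d%:R) ^+ k != 0 by rewrite expf_neq0// gt_eqF// mulr_gt0.
have Mk : (1 + M) ^+ k.+1 != 0 by rewrite expf_neq0// gt_eqF.
rewrite [_ ^+ k.+1 in X in _ = X]exprS [(1 + M) ^+ k.+2]exprS.
move: Xk Mk; set X := _ ^+ k; set Y := _ ^+ k.+1 => Xk Mk.
by field; rewrite Xk Mk !gt_eqF.
Qed.

Lemma green_error k : exists A : R, forall d, (0 < d)%N -> (k <= d)%N ->
  `|\prod_(j < k.+1) ((1 + M) / green_den d j) - 1| <= A / d%:R.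
Proof.
(* The two summands bound d times the terms subtracted from 1 + M in the denominator; the outer
   division uses that the denominator is at least M. *)
pose C := (k%:R + k.+1%:R / M) / M.
exists ((1 + C) ^+ k.+1 - 1) => d d0 kd.
have d0' : 0 < d%:R :> R by rewrite ltr0n.
have t01 : 0 <= (d%:R^-1 : R) <= 1 by rewrite invr_ge0 ler0n/= invf_le1// ler1n.
have C0 : 0 <= C by rewrite /C divr_ge0 ?addr_ge0 ?divr_ge0 ?(ltW M0).
have h j : (j < k.+1)%N -> 1 <= (1 + M) / green_den d j <= 1 + d%:R^-1 * C.
  rewrite ltnS => jk; have jd : (j <= d)%N by exact: leq_trans kd.
  have D0 := den_gt0 jd; rewrite ler_pdivlMr// mul1r den_le//=.
  rewrite ler_pdivrMr//.
  have /andP[u0 u1] := frac_itv R jd; have /andP[r0 r1] := ratio_itv N1 M0 d j.+1.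
  have rlin : (1 - j%:R / d%:R) * ratio N M d j.+1 <= k.+1%:R / d%:R / M.
    have rhs0 : 0 <= k.+1%:R / d%:R / M by rewrite !divr_ge0// ltW.
    (* At [j = d] the factor 1 - u vanishes; for smaller j the index j + 1 is within the range of
       [ratioE]. *)
    move: jd; rewrite leq_eqVlt => /predU1P[->|jd].
      by rewrite divff ?gt_eqF// subrr mul0r.
    apply: (@le_trans _ _ (ratio N M d j.+1)).
      by rewrite ler_piMl// gerBl.
    have := step_le_lin N1 M0 (frac_itv R jd) (ratio_itv N1 M0 d j.+2).
    rewrite -ratioE// => /le_trans; apply.
    by rewrite !ler_pM2r ?invr_gt0// ler_nat ltnS.
  have DM : M <= green_den d j.
    have := step_den_ge M N1 (frac_itv R jd) (ratio_itv N1 M0 d j.+1).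
    apply: le_trans.
    by rewrite lerDl divr_ge0// ltW.
  have uk : j%:R / d%:R * (N - 1) / N <= k%:R / d%:R.
    apply: (@le_trans _ _ (j%:R / d%:R)).
      by rewrite -mulrA ler_piMr// ler_pdivrMr// mul1r gerBl.
    by rewrite ler_pM2r ?invr_gt0// ler_nat.
  have DE : 1 + M - green_den d j <= d%:R^-1 * C * M.
    rewrite /C (_ : d%:R^-1 * _ * M = k%:R / d%:R + k.+1%:R / d%:R / M); last first.
      by field; rewrite !gt_eqF.
    by rewrite /green_den /step_den; lra.
  have : d%:R^-1 * C * M <= d%:R^-1 * C * green_den d j.
    by rewrite ler_wpM2l// mulr_ge0 ?invr_ge0.
  lra.
have /andP[p1 p2] := prod_near1 t01 C0 h.
by rewrite ger0_norm ?subr_ge0// mulrC lerBlDl.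
Qed.

Lemma greenE d k : (k <= d)%N ->
  green d k = (beta * green_den d 0)^-1 * expR (- log_sum N M d k).
Proof.
move=> kd; rewrite /green; congr (_ * _).
rewrite /log_sum -sumrN expR_sum; apply: eq_bigr => j _.
by rewrite opprK lnK// posrE ratio_gt0//= (leq_trans (ltn_ord j)).
Qed.

Lemma green_decay sigma eps : 0 < sigma <= 1 -> 0 < eps ->
  exists D, forall d, (D <= d)%N -> forall rho, (rho <= d)%N ->
    `|rho%:R - sigma * d%:R| < 1 ->
    expR (- (rate N M sigma + eps) * d%:R) <= green d rho
      <= expR (- (rate N M sigma - eps) * d%:R).
Proof.
move=> /andP[s0 s1] e0.
(* The prefactor's denominator lies between [beta * M] and [beta * (1 + M)], so C bounds its
   logarithm uniformly in d. *)
pose C := `|ln (beta * (1 + M))| + `|ln (beta * M)|.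
have s01 : 0 <= sigma <= 1 by rewrite s1 ltW.
have [D hD] := log_sum_asymp N1 M0 C s01 e0.
exists D => d Dd rho rhod hrho; have /andP[l1 l2] := hD d Dd rho rhod hrho.
have D0 := den_gt0 (leq0n d).
have DM : M <= green_den d 0.
  have := step_den_ge M N1 (frac_itv R (leq0n d)) (ratio_itv N1 M0 d 1).
  apply: le_trans.
  by rewrite lerDl divr_ge0// ?(ltW N0)// divr_ge0.
have lnD1 : ln (beta * green_den d 0) <= C.
  apply: (@le_trans _ _ (ln (beta * (1 + M)))).
    by rewrite ler_ln ?posrE ?mulr_gt0// ler_pM2l// den_le.
  by apply: (le_trans (ler_norm _)); rewrite lerDl.
have lnD2 : - C <= ln (beta * green_den d 0).
  apply: (@le_trans _ _ (ln (beta * M))).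
    rewrite lerNl; apply: (le_trans (ler_norm _)).
    by rewrite normrN lerDr.
  by rewrite ler_ln ?posrE ?mulr_gt0// ler_pM2l.
rewrite greenE// -[X in X^-1]lnK ?posrE ?mulr_gt0// -expRN -expRD !ler_expR.
apply/andP; split; lra.
Qed.

End green_function.

Theorem proposition4p2 (R : realType) (n : nat) (m beta : R)
    (disp : nat -> measure_display)
    (Omega : forall d : nat, measurableType (disp d))
    (P : forall d : nat, probability (Omega d) R)
    (g : forall d : nat, config n d -> {RV (P d) >-> R})
    (hn : (2 <= n)%N) (hm : 0 < m) (hbeta : 0 < beta)
    (hg : forall d : nat, (2 <= d)%N -> is_gff m beta (g d)) :
  (forall rho : nat,
     exists2 err : nat -> R,
       err =O_\oo (fun d : nat => (d%:R : R)^-1) &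
       forall (d : nat) (x x' : config n d), (2 <= d)%N -> hamming x x' = rho ->
         covariance (P d) (g d x) (g d x') =
         ((rho`!)%:R / (beta * (1 + m ^+ 2) ^+ rho.+1)
            * expR (- rho%:R * ln (((n - 1) * d)%N%:R))
            * (1 + err d))%:E)
  /\
  (exists rate : R -> R,
     [/\ forall (sigma eps : R), 0 < sigma <= 1 -> 0 < eps ->
           \forall d \near \oo, forall x x' : config n d,
             `|(hamming x x')%:R - sigma * d%:R| < 1 ->
             ((expR (- (rate sigma + eps) * d%:R))%:E
                <= covariance (P d) (g d x) (g d x')
                <= (expR (- (rate sigma - eps) * d%:R))%:E)%E,
         exists2 c : R, 0 < c &
           forall sigma : R, 0 < sigma <= 1 -> c * sigma <= rate sigma &
         forall sigma tau : R, 0 < sigma -> sigma < tau -> tau <= 1 ->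
           rate sigma < rate tau]).
Proof.
have cov d x y : (2 <= d)%N ->
    covariance (P d) (g d x) (g d y) = (green n m beta d (hamming x y))%:E.
  by move=> d2; apply: covariance_gff => //; [exact: ltnW|exact: hg].
split.
- move=> rho; have [A hA] := green_error hn hm rho.
  (* A pair at distance rho exists only if [rho <= d]; outside the guarded range the error takes the
     default value 0. *)
  exists (fun d => if (0 < d)%N && (rho <= d)%N then
      \prod_(j < rho.+1) ((1 + m ^+ 2) / green_den n m d j) - 1 else 0).
    apply/eqOP; near=> k; near=> d.
    have d0 : (0 < d)%N by near: d; exists 1%N.
    case: ifPn => [/andP[_ rd]|_]; last by rewrite normr0 mulr_ge0.
    apply: (le_trans (hA _ d0 rd)).
    by rewrite ger0_norm ?invr_ge0// ler_wpM2r ?invr_ge0.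
  move=> d x y d2 xy; rewrite cov// xy.
  have d0 : (0 < d)%N by exact: ltnW.
  have rd : (rho <= d)%N by rewrite -xy hamming_le.
  rewrite d0 rd (green_expansion hn hm hbeta d0 rd); congr (_ * _)%:E.
  by rewrite [RHS]addrC subrK.
- exists (rate (n - 1)%N%:R (m ^+ 2)); split.
  + move=> sigma eps s01 e0.
    have [D hD] := green_decay hn hm hbeta s01 e0.
    (* The covariance formula is available only from dimension 2 on. *)
    exists (maxn 2 D) => // d; rewrite /= geq_max => /andP[d2 Dd] x y xy.
    by rewrite cov// !lee_fin; apply: hD => //; exact: hamming_le.
  + exists (ln (1 + m ^+ 2)); first by rewrite ln_gt0// ltrDl exprn_gt0.
    move=> sigma /andP[s0 s1]; apply: rate_ge.
    * by rewrite ler1n subn_gt0.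
    * exact: exprn_gt0.
    * by rewrite s1 ltW.
  + move=> sigma tau s0 st t1.
    apply: (@lt_le_trans _ _ (rate (n - 1)%N%:R (m ^+ 2) sigma
      + ln (1 + m ^+ 2) * (tau - sigma))).
      by rewrite ltrDl mulr_gt0 ?subr_gt0// ln_gt0// ltrDl exprn_gt0.
    apply: rate_incr => //.
    * by rewrite ler1n subn_gt0.
    * exact: exprn_gt0.
    * exact: ltW.
    * exact: ltW.
Unshelve. all: by end_near.
Qed.
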